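(* Let $\{q_{\pm}^{i}(z)\}_{i=1}^{r}$ be an isolated solution of the infinite $qq$-system associated to $\mathfrak{g}$ and monic polynomials $\Lambda_1(z),\ldots,\Lambda_r(z)\in\mathbb{C}[z]$. Then there exist $\epsilon>0$ and polynomials $\{q_{\pm}^{i,Z^{H}}(z)\}_{i=1}^{r}$ that lift $\{q_{\pm}^{i}(z)\}_{i=1}^{r}$ and solve the $qq$-system $$W(q_{+}^{i,Z^H},q_{-}^{i,Z^H})(z)+\langle\alpha_{i},Z^H\rangle\, q_{+}^{i,Z^H}(z)\,q_{-}^{i,Z^H}(z)=\Lambda_{i}(z)\prod_{j\neq i}\big[q_{+}^{j,Z^H}(z)\big]^{-a_{ji}},\qquad i=1,\ldots,r,$$ for all $Z^{H}\in\mathfrak{h}$ satisfying $|t_{i}|<\epsilon$ for all $i$, where $t_i=\langle\alpha_i,Z^H\rangle^{-1}$.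
   Context: $\mathfrak{g}$ is a simple complex Lie algebra of rank $r$ with Cartan subalgebra $\mathfrak{h}$, simple roots $\alpha_1,\ldots,\alpha_r$, simple coroots $\check\alpha_1,\ldots,\check\alpha_r$, and Cartan matrix $a_{ij}=\langle\alpha_j,\check\alpha_i\rangle$. The Wronskian is $W(f,g)(z)=f(z)\partial_z g(z)-g(z)\partial_z f(z)$. The infinite $qq$-system associated to $\mathfrak{g}$ and monic polynomials $\Lambda_1,\ldots,\Lambda_r$ is the system of equations $$q_{+}^{i}(z)q_{-}^{i}(z)=\Lambda_{i}(z)\prod_{j\neq i}\big[q_{+}^{j}(z)\big]^{-a_{ji}},\qquad i=1,\ldots,r,$$ for polynomials $q_\pm^i(z)$ with the $q_+^i$ monic. A solution is isolated if it is an isolated point of the set of solutions having the same degrees (identified with tuples of coefficients). Put $\xi_i=\langle\alpha_i,Z^H\rangle$ and, when $\xi_i\ne 0$, $t_i=\xi_i^{-1}$; the condition $|t_i|<\epsilon$ includes $\xi_i\neq 0$. The infinite system is obtained from the $qq$-system by setting $\tilde q_-^i(z)=\xi_i q_-^i(z)$ and letting $\xi_i\to\infty$ for each $i$. Accordingly, the polynomials $q_\pm^{i,Z^H}$ lift $q_\pm^i$ if $q_+^{i,Z^H}$ is monic, $q_\pm^{i,Z^H}$ have the same degrees as $q_\pm^i$, and the coefficients of $q_+^{i,Z^H}(z)$ and of $\xi_i q_-^{i,Z^H}(z)$ tend to those of $q_+^i(z)$ and $q_-^i(z)$ as $(t_1,\ldots,t_r)\to(0,\ldots,0)$. *)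

(* Defs.v *)
From HB Require Import structures.
From mathcomp Require Import all_boot all_order all_algebra.
From mathcomp Require Import complex.
From mathcomp Require Import all_classical all_reals topology.

Set Implicit Arguments.
Unset Strict Implicit.
Unset Printing Implicit Defensive.

Import Order.TTheory GRing.Theory Num.Theory.
Local Open Scope ring_scope.

HB.mixin Record Vector_isLieAlgebra (K : fieldType) L of Vector K L := {
  lie : L -> L -> L;
  lie_linearl : forall y : L, linear (lie ^~ y);
  lie_linearr : forall x : L, linear (lie x);
  liexx : forall x : L, lie x x = 0;
  lie_jacobi : forall x y z : L,
    lie x (lie y z) + lie y (lie z x) + lie z (lie x y) = 0
}.

#[short(type="lieAlgType")]
HB.structure Definition LieAlgebra (K : fieldType) :=
  {L of Vector_isLieAlgebra K L & Vector K L}.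

Section LieTheory.
Variables (K : fieldType) (g : lieAlgType K).
Implicit Types (U V h : {vspace g}).

Definition lie_ideal V := forall x y : g, y \in V -> lie x y \in V.

Definition simple_lie :=
  (exists x y : g, lie x y != 0) /\
  (forall V, lie_ideal V -> V = 0%VS \/ V = fullv).

Definition lie_subalgebra h :=
  forall x y : g, x \in h -> y \in h -> lie x y \in h.

Definition liev U V : {vspace g} :=
  <<[seq lie x y | x <- vbasis U, y <- vbasis V]>>%VS.

Definition nilpotent_lie h := exists n : nat, iter n (liev h) h = 0%VS.

Definition cartan_subalgebra h :=
  [/\ lie_subalgebra h, nilpotent_lie h &
      forall x : g, (forall y : g, y \in h -> lie x y \in h) -> x \in h].

Variable h : {vspace g}.
Implicit Types beta : 'Hom(subvs_of h, K^o).

Definition in_root_space beta (x : g) :=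
  forall H : subvs_of h, lie (vsval H) x = (beta H : K) *: x.

Definition is_root beta :=
  beta != 0 /\ exists2 x : g, x != 0 & in_root_space beta x.

Definition simple_roots (r : nat) (alpha : 'I_r -> 'Hom(subvs_of h, K^o)) :=
  [/\ forall i, is_root (alpha i),
      basis_of fullv [seq alpha i | i : 'I_r] &
      forall beta, is_root beta -> exists n : 'I_r -> nat,
        beta = \sum_i alpha i *+ n i \/ beta = - (\sum_i alpha i *+ n i)].

(* The element H of [g_beta, g_(-beta)] with beta(H) = 2; root spaces of a
   semisimple g are lines, so one bracket of root vectors suffices. *)
Definition is_coroot beta (H : subvs_of h) :=
  beta H = 2%:R /\
  exists e f : g,
    [/\ in_root_space beta e, in_root_space (- beta) f & vsval H = lie e f].

End LieTheory.

Definition is_cartan_matrix (K : fieldType) (g : lieAlgType K)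
    (h : {vspace g}) (r : nat) (alpha : 'I_r -> 'Hom(subvs_of h, K^o))
    (alphav : 'I_r -> subvs_of h) (a : 'M[int]_r) :=
  forall i j, (a i j)%:~R = alpha j (alphav i).

Section QQSystem.
Variables (K : fieldType) (r : nat) (a : 'M[int]_r) (Lambda : 'I_r -> {poly K}).
Implicit Types (p m : 'I_r -> {poly K}).

Definition Wronskian (f g : {poly K}) : {poly K} := f * g^`() - g * f^`().

(* The exponents [- a j i], [j != i], are natural numbers for a Cartan matrix,
   so the integer power is an ordinary power of a polynomial. *)
Definition qq_rhs p (i : 'I_r) : {poly K} :=
  Lambda i * \prod_(j < r | j != i) p j ^ (- a j i).

Definition qq_system (xi : 'I_r -> K) p m :=
  forall i, Wronskian (p i) (m i) + xi i *: (p i * m i) = qq_rhs p i.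

Definition infinite_qq_solution p m :=
  (forall i, p i \is monic) /\ (forall i, p i * m i = qq_rhs p i).

Definition same_degrees p m p' m' :=
  forall i, size (p' i) = size (p i) /\ size (m' i) = size (m i).

End QQSystem.

Section Isolated.
Local Open Scope classical_set_scope.
Variables (R : realType) (r : nat).
Local Notation C := R[i].
Implicit Types (p m : 'I_r -> {poly C}).

(* [C^o] is C with its usual topology, which makes the type of coefficient
   arrays a finite-dimensional space with the product topology. *)
Definition coef_tuple (N : nat) p m : 'M[C^o]_(r, N) * 'M[C^o]_(r, N) :=
  (\matrix_(i, k) (p i)`_k, \matrix_(i, k) (m i)`_k).

Definition max_size p m : nat := \max_(i < r) maxn (size (p i)) (size (m i)).

(* With N = [max_size p m] a solution of the same degrees as (p, m) is
   determined by its coefficient tuple. *)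
Definition isolated_solution (a : 'M[int]_r) (Lambda : 'I_r -> {poly C}) p m :=
  infinite_qq_solution a Lambda p m /\
  let N := max_size p m in
  isolated
    [set coef_tuple N s.1 s.2 | s in
      [set s | infinite_qq_solution a Lambda s.1 s.2 /\
               same_degrees p m s.1 s.2]]
    (coef_tuple N p m).

End Isolated.

Section Lift.
Local Open Scope classical_set_scope.
Local Open Scope complex_scope.
Variables (R : realType) (g : lieAlgType R[i]) (h : {vspace g}) (r : nat).
Variable alpha : 'I_r -> 'Hom(subvs_of h, R[i]^o).
Implicit Types (p m : 'I_r -> {poly R[i]}).

(* |t_i| < e, where t_i is the inverse of alpha_i(Z).  The condition
   [alpha i Z != 0] is needed because 0^-1 = 0. *)
Definition t_ball (e : R) : set (subvs_of h) :=
  [set Z | forall i, alpha i Z != 0 /\ `|(alpha i Z)^-1| < e%:C].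

(* The filter (t_1, ..., t_r) --> (0, ..., 0) on Z. *)
Definition t_to_0 : set_system (subvs_of h) :=
  filter_from [set e : R | 0 < e] t_ball.

Definition lifts (eps : R) p m (P M : subvs_of h -> 'I_r -> {poly R[i]}) :=
  [/\ forall Z, t_ball eps Z -> forall i, P Z i \is monic,
      forall Z, t_ball eps Z -> same_degrees p m (P Z) (M Z),
      forall i k,
        ((P Z i)`_k : R[i]^o) @[Z --> t_to_0] --> ((p i)`_k : R[i]^o) &
      forall i k,
        ((alpha i Z *: M Z i)`_k : R[i]^o) @[Z --> t_to_0] -->
          ((m i)`_k : R[i]^o)].

End Lift.

(* Main.v *)
From HB Require Import structures.
Require Import Defs.
From mathcomp Require Import all_boot all_order all_algebra.
From mathcomp Require Import complex.
From mathcomp Require ssrcomplements mpoly.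
From mathcomp Require Import zify ring lra.

(** In terms of [q_-^i] multiplied by [xi_i = t_i^-1], the [i]-th equation reads
    [q_+ q_- + t_i W(q_+, q_-) = rhs]: it is polynomial in [t] and becomes the
    infinite system at [t = 0].  All the polynomials are monic and the Wronskian
    has lower degree than the product, so the unknowns are the coefficients below
    the leading ones, and the equations that remain are as many as the unknowns.
    The theorem is therefore an instance of a general principle: an isolated
    common zero of [n] polynomials [F i] in [n] complex unknowns does not
    disappear when small polynomials [G i] are added ([perturbed_zero]).  Isolated
    solutions can be multiple, so the implicit function theorem does not suffice.

    To see the principle, put the zero at the origin and surround it by a shell
    that contains no zero of [F].  For a small [s != 0] and [N] larger than all
    the degrees, consider the system [s x_i^N + F i + t G i].  The origin solves it
    for [t = 0], and it has no zero in the shell when [|t| <= 1].  The leading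
    terms [x_i^N] prevent zeros from escaping to infinity: whatever [t] is, the
    polynomial ring modulo the system is free on the monomials with exponents
    less than [N].  This holds because the base-[N] substitution
    [x_i^(b N + a) |-> H_i^b x_i^a] is unitriangular for the degree, where [H_i] is
    the [i]-th polynomial divided by [s] ([twist], [multiplication_table_exists]).
    Multiplications by the variables are thus commuting matrices of a fixed
    size, with entries polynomial in [t].  Common zeros are their joint
    eigenvalues, and a simultaneous unitary triangularization shows that
    a zero at [t] is close to a zero at every nearby [t'], uniformly
    ([zeros_continuous]).  Going from [t = 0] to [t = 1] by small steps, a zero
    inside the shell cannot get across it ([zero_in_ball]).  Finally [s] tends to
    [0], and compactness gives a zero of [F + G].

    For each [Z], the lift is the solution of the deformed system whose
    coefficients are closest to those of the given one; since there are solutions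
    arbitrarily close to it as [t] tends to [0], the lift converges to it. *)

Set Implicit Arguments.
Unset Strict Implicit.
Unset Printing Implicit Defensive.

Import Order.TTheory GRing.Theory Num.Theory.
Local Open Scope ring_scope.

(** * Quotients by leading powers of the variables *)

Module PolynomialSystems.
Import ssrcomplements mpoly.

Lemma msizeM_le_pred (R : comNzRingType) n (p q : {mpoly R[n]}) :
  (msize (p * q) <= (msize p + msize q).-1)%N.
Proof.
rewrite msizeE; apply/bigmax_leqP_seq => m /msuppM_le /allpairsP.
case=> -[m1 m2] [/= m1p m2q ->] _; rewrite mdegD.
have:= msize_mdeg_lt m1p; have:= msize_mdeg_lt m2q; lia.
Qed.

Section CompleteIntersection.
Variables (R : comNzRingType) (n N : nat) (L : 'I_n -> {mpoly R[n]}).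
Hypothesis N_gt0 : (0 < N)%N.
Hypothesis msizeL : forall i, (msize (L i) <= N)%N.

Let H i : {mpoly R[n]} := 'X_i ^+ N + L i.

(** Taking the top monomial as an argument makes it compatible with products,
    with no assumption on [R] and no choice of a monomial order. *)
Definition leads_to (q : {mpoly R[n]}) m := (msize (q - 'X_[m]) <= mdeg m)%N.

Lemma leads_toX m : leads_to 'X_[m] m.
Proof. by rewrite /leads_to subrr msize0. Qed.

Lemma leads_to_msize q m : leads_to q m -> (msize q <= (mdeg m).+1)%N.
Proof.
rewrite /leads_to => qm; rewrite -(subrK 'X_[m] q).
apply: leq_trans (msizeD_le _ _) _; rewrite geq_max msizeX leqnn andbT.
exact: leq_trans qm _.
Qed.

Lemma leads_toM q1 m1 q2 m2 :
  leads_to q1 m1 -> leads_to q2 m2 -> leads_to (q1 * q2) (m1 + m2)%MM.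
Proof.
move=> l1 l2; rewrite /leads_to mpolyXD.
have ->: q1 * q2 - 'X_[m1] * 'X_[m2] =
    (q1 - 'X_[m1]) * q2 + 'X_[m1] * (q2 - 'X_[m2]).
  by rewrite mulrBl mulrBr addrA subrK.
apply: leq_trans (msizeD_le _ _) _; rewrite geq_max.
rewrite (leq_trans (msizeM_le_pred _ _)) ?(leq_trans (msizeM_le_pred _ _)) //.
- rewrite msizeX mdegD; move: l2; rewrite /leads_to; lia.
- have:= leads_to_msize l2; move: l1; rewrite /leads_to mdegD; lia.
Qed.

Lemma leads_toXn q m k : leads_to q m -> leads_to (q ^+ k) (m *+ k)%MM.
Proof.
move=> qm; elim: k => [|k IH]; last by rewrite exprS mulmS; apply: leads_toM.
by rewrite expr0 mulm0n -mpolyX0; apply: leads_toX.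
Qed.

Lemma leads_to_prod (I : finType) (q : I -> {mpoly R[n]}) m :
  (forall i, leads_to (q i) (m i)) ->
  leads_to (\prod_i q i) (\big[mnm_add/0%MM]_i m i).
Proof.
move=> qm; elim/big_rec2: _ => [|i m' q' _]; last exact: leads_toM.
by rewrite -mpolyX0; apply: leads_toX.
Qed.

Lemma leads_to_H i : leads_to (H i) (U_(i) *+ N)%MM.
Proof.
by rewrite /leads_to /H mpolyXn addrC addKr mdegMn mdeg1 mul1n.
Qed.

Definition residue (m : 'X_{1..n}) := [multinom (m i %% N)%N | i < n].

Definition twistX (m : 'X_{1..n}) : {mpoly R[n]} :=
  (\prod_i H i ^+ (m i %/ N)) * 'X_[residue m].

(** The twist turns the ideal generated by the powers ['X_i ^+ N] into the ideal
    generated by the [H i], and identifies the quotients. *)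
Definition twist (q : {mpoly R[n]}) := \sum_(m <- msupp q) q@_m *: twistX m.

Lemma leads_to_twistX m : leads_to (twistX m) m.
Proof.
have {2}->: m = (\big[mnm_add/0%MM]_i (U_(i) *+ N *+ (m i %/ N)) + residue m)%MM.
  apply/mnmP => j; rewrite mnmDE mnm_sumE mnmE (bigD1 j) //= big1.
    by rewrite !mulmnE mnm1E eqxx mul1n addn0 mulnC -divn_eq.
  by move=> i /negPf ij; rewrite !mulmnE mnm1E ij.
by apply: leads_toM (leads_toX _); apply: leads_to_prod => i;
  apply: leads_toXn; apply: leads_to_H.
Qed.

Lemma twistE k q : (msize q <= k)%N ->
  twist q = \sum_(m : 'X_{1..n < k}) q@_m *: twistX m.
Proof.
move=> le_qk; set I : subFinType _ := 'X_{1..n < k}.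
rewrite /twist (big_mksub I) ?msupp_uniq //=; first last.
  by move=> x /msize_mdeg_lt /leq_trans; apply.
by rewrite big_rmcond //= => j /memN_msupp_eq0 ->; rewrite scale0r.
Qed.

Lemma twist_is_linear : linear twist.
Proof.
move=> c p q; pose k := maxn (msize p) (maxn (msize q) (msize (c *: p + q))).
rewrite !(twistE (k := k)) ?leq_max ?leqnn ?orbT // scaler_sumr -big_split /=.
by apply: eq_bigr => m _; rewrite mcoeffD mcoeffZ scalerDl scalerA.
Qed.

HB.instance Definition _ := GRing.isLinear.Build R {mpoly R[n]} {mpoly R[n]} _
  twist twist_is_linear.

Lemma twist_X m : twist 'X_[m] = twistX m.
Proof. by rewrite /twist msuppX big_seq1 mcoeffX eqxx scale1r. Qed.

(** The twist is unitriangular for the degree, which makes it bijective. *)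
Lemma twist_diff q : (msize (twist q - q) <= (msize q).-1)%N.
Proof.
rewrite /twist [X in _ - X]mpolyE -sumrB.
apply: leq_trans (msize_sum _ _ _) _; apply/bigmax_leqP_seq => m mq _.
rewrite -scalerBr (leq_trans (msizeZ_le _ _)) //.
by apply: leq_trans (leads_to_twistX m) _; have:= msize_mdeg_lt mq; lia.
Qed.

Lemma twist_eq0 q : twist q = 0 -> q = 0.
Proof.
move=> q0; apply/eqP; rewrite -msize_poly_eq0.
by have:= twist_diff q; rewrite q0 sub0r msizeN; lia.
Qed.

Lemma twist_surj p : exists q, twist q == p.
Proof.
have [k] := ubnP (msize p); elim: k p => // k IH p lepk.
have [p0|p_neq0] := eqVneq p 0; first by exists 0; rewrite p0 linear0.
have pos: (0 < msize p)%N by rewrite lt0n msize_poly_eq0.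
have [|q /eqP qE] := IH (twist p - p); first by have:= twist_diff p; lia.
by exists (p - q); rewrite linearB /= qE opprB addrC subrK.
Qed.

Definition untwist p := xchoose (twist_surj p).

Lemma untwistK p : twist (untwist p) = p.
Proof. exact/eqP/(xchooseP (twist_surj p)). Qed.

Lemma twist_inj : injective twist.
Proof.
move=> p q pq; apply/eqP; rewrite -subr_eq0.
by apply/eqP/twist_eq0; rewrite linearB /= pq subrr.
Qed.

Lemma twistK q : untwist (twist q) = q.
Proof. by apply: twist_inj; rewrite untwistK. Qed.

Lemma untwist_is_linear : linear untwist.
Proof. by move=> c p q; apply: twist_inj; rewrite linearP /= !untwistK. Qed.

HB.instance Definition _ := GRing.isLinear.Build R {mpoly R[n]} {mpoly R[n]} _
  untwist untwist_is_linear.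

Lemma twistX_MH i m : twistX (m + U_(i) *+ N)%MM = H i * twistX m.
Proof.
rewrite /twistX mulrA; congr (_ * 'X_[_]); last first.
  apply/mnmP => j; rewrite !mnmE mulmnE.
  by rewrite addnC modnMDl.
rewrite (bigD1 i) //= [in RHS](bigD1 i) //= mulrA -exprS; congr (_ ^+ _ * _).
  by rewrite mnmDE mulmnE mnm1E eqxx mul1n divnDr ?dvdnn // divnn N_gt0 addn1.
apply: eq_bigr => j /negPf ji; congr (_ ^+ _).
by rewrite mnmDE mulmnE mnm1E eq_sym ji addn0.
Qed.

(** This is how the twist exchanges the two ideals. *)
Lemma twist_MH i q : twist ('X_[U_(i) *+ N] * q) = H i * twist q.
Proof.
elim/mpolyind: q => [|c m p _ _ IH]; first by rewrite mulr0 linear0 mulr0.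
rewrite mulrDr !linearD /= IH mulrDr; congr (_ + _).
by rewrite -scalerAr !linearZ /= -mpolyXD !twist_X addmC twistX_MH scalerAr.
Qed.

Definition basis_index := {ffun 'I_n -> 'I_N}.

Definition basisX (a : basis_index) : 'X_{1..n} := [multinom (a i : nat) | i < n].

Lemma basisX_inj : injective basisX.
Proof.
by move=> a b ab; apply/ffunP => i; apply: val_inj; have /mnmP/(_ i) := ab; rewrite !mnmE.
Qed.

Lemma basisXP (m : 'X_{1..n}) : (forall i, (m i < N)%N) -> exists a, m = basisX a.
Proof.
move=> mN; exists [ffun i => Ordinal (mN i)].
by apply/mnmP => i; rewrite mnmE ffunE.
Qed.

(** As the twist identifies the quotients by the ['X_i ^+ N] and by the [H i], the
    coefficients of [untwist p] at the reduced monomials are coordinates for the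
    latter. *)
Definition coordX p a := (untwist p)@_(basisX a).

Lemma coordX_basis a b : coordX 'X_[basisX a] b = (a == b)%:R.
Proof.
have tw: twistX (basisX a) = 'X_[basisX a].
  rewrite /twistX big1 ?mul1r.
    by congr 'X_[_]; apply/mnmP => i; rewrite !mnmE modn_small.
  by move=> i _; rewrite mnmE divn_small.
by rewrite /coordX -{1}tw -twist_X twistK mcoeffX (inj_eq basisX_inj).
Qed.

Lemma coordX_MH i p a : coordX (H i * p) a = 0.
Proof.
rewrite /coordX -[p]untwistK -twist_MH twistK.
apply: memN_msupp_eq0; apply/negP => /msuppM_le /allpairsP [[m1 m2]] /=.
rewrite msuppX inE => -[/eqP -> _ /mnmP/(_ i)].
rewrite !mnmE mulmnE mnm1E eqxx mul1n.
by have:= ltn_ord (a i); lia.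
Qed.

(** The elements with all coordinates zero form the ideal of the [H i]: they
    are combinations of twisted monomials having a factor [H i].  The ideal
    appears here through an induction principle. *)
Lemma coordX0_ind (P : {mpoly R[n]} -> Prop) p :
  P 0 -> (forall c q r, P q -> P r -> P (c *: q + r)) ->
  (forall i q, P (H i * q)) -> (forall a, coordX p a = 0) -> P p.
Proof.
move=> P0 PD PH p0; rewrite -[p]untwistK.
rewrite /twist big_seq; elim/big_rec: _ => // m q mp Pq; apply: (PD) => //.
have [/forallP mN|] := boolP [forall i, (m i < N)%N].
  have [a ma] := basisXP mN; move: mp; rewrite mcoeff_msupp ma.
  by move: (p0 a); rewrite /coordX => ->; rewrite eqxx.
rewrite negb_forall => /existsP[ i ]; rewrite -leqNgt => Nmi.
suff ->: m = ((m - U_(i) *+ N) + U_(i) *+ N)%MM by rewrite twistX_MH; apply: PH.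
rewrite submK //; apply/mnm_lepP => j; rewrite mulmnE mnm1E.
by case: eqP => [<-|_]; rewrite ?mul1n.
Qed.

Lemma coordXD p q a : coordX (p + q) a = coordX p a + coordX q a.
Proof. by rewrite /coordX linearD mcoeffD. Qed.

Lemma coordXZ c p a : coordX (c *: p) a = c * coordX p a.
Proof. by rewrite /coordX linearZ mcoeffZ. Qed.

Definition remainder p := p - \sum_a coordX p a *: 'X_[basisX a].

Lemma coordX_comb (c : basis_index -> R) a :
  coordX (\sum_b c b *: 'X_[basisX b]) a = c a.
Proof.
rewrite /coordX linear_sum raddf_sum /= (bigD1 a) //= big1 => [|b ba].
  by rewrite linearZ mcoeffZ [_@__]coordX_basis eqxx mulr1 addr0.
by rewrite linearZ mcoeffZ [_@__]coordX_basis (negPf ba) mulr0.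
Qed.

Lemma coordX_remainder p a : coordX (remainder p) a = 0.
Proof.
by rewrite /remainder coordXD -scaleN1r coordXZ coordX_comb mulN1r subrr.
Qed.

Lemma coordX_ideal p q : (forall a, coordX q a = 0) ->
  forall a, coordX (p * q) a = 0.
Proof.
apply: (@coordX0_ind (fun q => forall a, coordX (p * q) a = 0)).
- by move=> a; rewrite mulr0 /coordX linear0 mcoeff0.
- move=> c q1 q2 h1 h2 a.
  by rewrite mulrDr -scalerAr coordXD coordXZ h1 h2 mulr0 addr0.
- by move=> i q' a; rewrite mulrCA coordX_MH.
Qed.

Local Notation D := #|basis_index|.

(** The matrix of the multiplication by [p] on the quotient.  It acts on row
    vectors, which reverses products. *)
Definition mulX p : 'M[R]_D :=
  \matrix_(k, l) coordX (p * 'X_[basisX (enum_val k)]) (enum_val l).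

Lemma mulXD p q : mulX (p + q) = mulX p + mulX q.
Proof. by apply/matrixP => k l; rewrite !mxE mulrDl coordXD. Qed.

Lemma mulXZ c p : mulX (c *: p) = c *: mulX p.
Proof. by apply/matrixP => k l; rewrite !mxE -scalerAl coordXZ. Qed.

Lemma mulX1 : mulX 1 = 1%:M.
Proof.
apply/matrixP => k l; rewrite !mxE mul1r coordX_basis.
by rewrite (inj_eq enum_val_inj).
Qed.

Lemma mulXM p q : mulX (p * q) = mulX q *m mulX p.
Proof.
apply/matrixP => k l; rewrite !mxE -mulrA.
set r := q * _.
have ->: p * r = p * (\sum_a coordX r a *: 'X_[basisX a]) + p * remainder r.
  by rewrite /remainder -mulrDr addrC subrK.
rewrite coordXD (coordX_ideal _ (coordX_remainder _)) addr0.
rewrite mulr_sumr /coordX linear_sum raddf_sum /=.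
rewrite (reindex _ (onW_bij _ (@enum_val_bij basis_index))) /=.
by apply: eq_bigr => j _; rewrite -scalerAr linearZ mcoeffZ !mxE.
Qed.

Lemma mulXH i : mulX (H i) = 0.
Proof. by apply/matrixP => k l; rewrite !mxE coordX_MH. Qed.

Section Evaluation.
Variables (S : comNzRingType) (f : {rmorphism R -> S}) (x : 'I_n -> S).
Hypothesis Hx : forall i, mmap f x (H i) = 0.

Definition evalX : 'cV[S]_D := \col_k mmap f x 'X_[basisX (enum_val k)].

(** At a common zero [x] of the [H i], evaluation at [x] factors through the
    quotient, so it is a joint eigenvector of all the multiplications. *)
Lemma mulX_eigen p : map_mx f (mulX p) *m evalX = mmap f x p *: evalX.
Proof.
apply/matrixP => k j; rewrite !mxE -[in RHS]rmorphM /=.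
set r := p * _.
have r0 : mmap f x (remainder r) = 0.
  apply: (@coordX0_ind (fun q => mmap f x q = 0)) (coordX_remainder r).
  - by rewrite mmap0.
  - by move=> c q1 q2 h1 h2; rewrite mmapD mmapZ h1 h2 mulr0 addr0.
  - by move=> i q'; rewrite rmorphM /= Hx mul0r.
have ->: r = \sum_a coordX r a *: 'X_[basisX a] + remainder r.
  by rewrite /remainder addrC subrK.
rewrite mmapD r0 addr0 raddf_sum /=.
rewrite (reindex _ (onW_bij _ (@enum_val_bij basis_index))) /=.
by apply: eq_bigr => l _; rewrite mmapZ !mxE.
Qed.

End Evaluation.

End CompleteIntersection.

(** What matters about the quotient of [{mpoly R[n]}] by the [H i]: the matrices
    of its multiplications, and the eigenvector given by a common zero. *)
Record multiplication_table (R : comNzRingType) n N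
    (H : 'I_n -> {mpoly R[n]}) D (M : {mpoly R[n]} -> 'M[R]_D) : Prop := {
  table_linear : forall c p q, M (c *: p + q) = c *: M p + M q;
  table_mul : forall p q, M (p * q) = M p *m M q;
  table_one : M 1 = 1%:M;
  table_rel : forall i, M (H i) = 0;
  table_eigen : forall (S : comNzRingType) (f : {rmorphism R -> S}) x,
    (forall i, mmap f x (H i) = 0) ->
    exists v : 'cV[S]_D,
      [/\ exists k, v k ord0 = 1,
          forall k, exists2 a : 'I_n -> nat,
            (forall i, (a i < N)%N) & v k ord0 = \prod_i x i ^+ a i &
          forall p, map_mx f (M p) *m v = mmap f x p *: v]
}.

Lemma multiplication_table_exists (R : comNzRingType) n N
    (L : 'I_n -> {mpoly R[n]}) :
  (0 < N)%N -> (forall i, (msize (L i) <= N)%N) ->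
  exists D (M : {mpoly R[n]} -> 'M[R]_D),
    multiplication_table N (fun i => 'X_i ^+ N + L i) M.
Proof.
move=> N0 LN; exists #|basis_index n N|, (mulX N0 LN); split.
- by move=> c p q; rewrite mulXD mulXZ.
- by move=> p q; rewrite mulrC mulXM.
- exact: mulX1.
- exact: mulXH.
move=> S f x Hx; exists (evalX N f x); split; last exact: mulX_eigen.
- exists (enum_rank [ffun _ => Ordinal N0]); rewrite mxE enum_rankK.
  rewrite (_ : basisX _ = 0%MM) ?mpolyX0 ?rmorph1 //.
  by apply/mnmP => i; rewrite !mnmE ffunE.
- move=> k; exists (basisX (enum_val k)); first by move=> i; rewrite mnmE.
  by rewrite mxE mmapX.
Qed.

(** * Continuity of the common zeros *)

Section Triangular.
Variable K : nzRingType.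

Lemma is_trig_mxM n (A B : 'M[K]_n) :
  is_trig_mx A -> is_trig_mx B -> is_trig_mx (A *m B).
Proof.
move=> /is_trig_mxP At /is_trig_mxP Bt; apply/is_trig_mxP => i j ij.
rewrite mxE big1 // => l _.
by case: (ltnP i l) => [/At ->|li]; rewrite ?mul0r // Bt ?mulr0 // (leq_ltn_trans li).
Qed.

Lemma trig_mxM_diag n (A B : 'M[K]_n) i :
  is_trig_mx A -> is_trig_mx B -> (A *m B) i i = A i i * B i i.
Proof.
move=> /is_trig_mxP At /is_trig_mxP Bt.
rewrite mxE (bigD1 i) //= big1 ?addr0 // => l li.
case: (ltngtP i l) => [/At ->|/Bt ->|/val_inj il]; rewrite ?mul0r ?mulr0 //.
by rewrite il eqxx in li.
Qed.

Lemma is_trig_mxD n (A B : 'M[K]_n) :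
  is_trig_mx A -> is_trig_mx B -> is_trig_mx (A + B).
Proof.
move=> /is_trig_mxP At /is_trig_mxP Bt; apply/is_trig_mxP => i j ij.
by rewrite mxE At ?Bt ?addr0.
Qed.

Lemma is_trig_mxZ n c (A : 'M[K]_n) : is_trig_mx A -> is_trig_mx (c *: A).
Proof.
by move=> /is_trig_mxP At; apply/is_trig_mxP => i j ij; rewrite mxE At ?mulr0.
Qed.

End Triangular.

Section Approximation.
Variable C : numClosedFieldType.

Lemma norm_sum_le n (F : 'I_n -> C) b :
  (forall i, `|F i| <= b) -> `|\sum_i F i| <= n%:R * b.
Proof.
move=> Fb; apply: le_trans (ler_norm_sum _ _ _) _.
by apply: le_trans (ler_sum _ (fun i _ => Fb i)) _; rewrite sumr_const card_ord mulr_natl.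
Qed.

(** The first index [k] at which the vector exceeds a threshold is suitable for all
    the matrices, when the thresholds increase geometrically with the index by a
    large factor: in row [k] of [M j *m w], the terms before the diagonal one are
    then negligible, and those after it vanish. *)
Lemma trig_approx_kernel n (B b rho : C) : 0 <= B -> 0 < b -> 0 < rho ->
  exists2 e : C, 0 < e & forall (J : Type) (M : J -> 'M[C]_n) (w : 'cV[C]_n),
    (forall j, is_trig_mx (M j)) -> (forall j k l, `|M j k l| <= B) ->
    (exists k, b <= `|w k ord0|) ->
    (forall j k, `|(M j *m w) k ord0| <= e) ->
    exists k, forall j, `|M j k k| <= rho.
Proof.
move=> B0 b0 rho0; have nB0 : 0 <= n%:R * B by rewrite mulr_ge0 ?ler0n.
have den0 : 0 < n%:R * B + rho by rewrite ltr_wpDl.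
have rho20 : 0 < rho / 2%:R by rewrite divr_gt0 ?ltr0n.
pose c := rho / 2%:R / (n%:R * B + rho).
have c0 : 0 < c by rewrite divr_gt0.
have c1 : c <= 1.
  by rewrite ler_pdivrMr // mul1r {2}(splitr rho) addrA lerDr addr_ge0 // ltW.
have ncB : n%:R * B * c <= rho / 2%:R.
  by rewrite /c mulrA ler_pdivrMr // mulrC ler_pM2l // lerDl ltW.
exists (rho / 2%:R * (b * c ^+ n)).
  by rewrite mulr_gt0 ?divr_gt0 ?ltr0n ?mulr_gt0 ?exprn_gt0.
move=> J M w Mtrig MB [k0 k0b] Mw.
pose P (k : 'I_n) := b * c ^+ (n - k) <= `|w k ord0|.
have Pk0 : P k0.
  apply: le_trans k0b; rewrite -[leRHS]mulr1 ler_pM2l //.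
  by apply: exprn_ile1 => //; apply: ltW.
case: (arg_minnP (fun k : 'I_n => k : nat) Pk0) => k Pk kmin.
exists k => j.
have wk0 : 0 < b * c ^+ (n - k) by rewrite mulr_gt0 ?exprn_gt0.
rewrite -(ler_pM2r wk0); apply: le_trans (_ : `|M j k k| * `|w k ord0| <= _).
  by rewrite ler_wpM2l.
have -> : `|M j k k| * `|w k ord0| =
    `|(M j *m w) k ord0 - \sum_(l | l != k) M j k l * w l ord0|.
  by rewrite -normrM mxE (bigD1 k) //= addrK.
apply: le_trans (ler_normB _ _) _.
rewrite [leRHS](_ : _ = rho / 2%:R * (b * c ^+ (n - k)) +
   rho / 2%:R * (b * c ^+ (n - k))); last first.
  by rewrite -mulrDl -splitr.
apply: lerD.
  apply: le_trans (Mw j k) _; rewrite ler_pM2l ?divr_gt0 ?ltr0n // ler_pM2l //.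
  by apply: ler_wiXn2l; rewrite ?leq_subr // ltW.
apply: le_trans (_ : n%:R * (B * (b * c ^+ (n - k).+1)) <= _); last first.
  rewrite [leLHS](_ : _ = n%:R * B * c * (b * c ^+ (n - k))).
    by rewrite ler_pM2r.
  by rewrite exprS; ring.
rewrite big_mkcond; apply: norm_sum_le => l.
have [lk|lk] := boolP (l != k); last first.
  by rewrite normr0 !mulr_ge0 ?exprn_ge0 // ltW.
rewrite normrM; have [kl|le_lk] := ltnP k l.
  by have /is_trig_mxP -> // := Mtrig j; rewrite normr0 mul0r !mulr_ge0 ?exprn_ge0 // ltW.
apply: ler_pM => //.
have lk' : (l < k)%N by rewrite ltn_neqAle (inj_eq val_inj) lk.
apply: le_trans (_ : b * c ^+ (n - l) <= _).
  rewrite real_leNgt ?realE ?normr_ge0 // ?mulr_ge0 ?exprn_ge0 ?(ltW b0) ?(ltW c0) //.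
  by apply/negP => /ltW /kmin; rewrite leqNgt lk'.
rewrite ler_pM2l // ler_wiXn2l ?(ltW c0) //.
by rewrite ltn_sub2l // (leq_trans lk') // ltnW.
Qed.

Lemma horner_lipschitz (p : {poly C}) : exists2 K, 0 <= K &
  forall t, `|t| <= 1 -> `|p.[t]| <= K /\
    forall t', `|t'| <= 1 -> `|p.[t'] - p.[t]| <= K * `|t' - t|.
Proof.
elim/poly_ind: p => [|p c [K K0 pK]].
  by exists 0 => // t t1; rewrite horner0 normr0; split=> // t' _;
    rewrite horner0 subrr normr0 mul0r.
exists (K + K + `|c|) => [|t t1]; first by rewrite !addr_ge0.
have [pt pt'] := pK t t1; rewrite !hornerE; split=> [|t' t'1].
  apply: le_trans (ler_normD _ _) _; rewrite lerD2r normrM.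
  apply: le_trans (_ : K * 1 <= _); first by rewrite ler_pM.
  by rewrite mulr1 lerDl.
rewrite !hornerE.
have -> : p.[t'] * t' + c - (p.[t] * t + c) =
    (p.[t'] - p.[t]) * t' + p.[t] * (t' - t) by ring.
apply: le_trans (ler_normD _ _) _; rewrite !normrM -addrA mulrDl.
apply: lerD.
  by rewrite -[leRHS]mulr1 ler_pM // pt'.
by rewrite ler_wpM2r // (le_trans pt) // lerDl.
Qed.

Lemma uniform_bound (T : finType) (P : T -> C -> Prop) :
  (forall t K K', K <= K' -> P t K -> P t K') ->
  (forall t, exists2 K, 0 <= K & P t K) ->
  exists2 K, 0 <= K & forall t, P t K.
Proof.
move=> Pmon /fin_all_exists2 [K K0 PK]; exists (\sum_t K t) => [|t].
  exact: sumr_ge0.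
by apply: Pmon (PK t); rewrite (bigD1 t) //= lerDl sumr_ge0.
Qed.

Lemma unitarymx_entry n (U : 'M[C]_n) i j : U \is unitarymx -> `|U i j| <= 1.
Proof.
move=> /unitarymxP /matrixP/(_ i i); rewrite !mxE eqxx => UU.
rewrite -(@ler_pXn2r _ 2) ?nnegrE // expr1n normCK -[leRHS]UU (bigD1 j) //= !mxE lerDl.
by apply: sumr_ge0 => l _; rewrite !mxE mul_conjC_ge0.
Qed.

(** [R] is a ring of functions of a parameter, and [f t] their evaluation at [t]. *)
Section Zeros.
Variables (R : comNzRingType) (f : C -> {rmorphism R -> C}).
Hypothesis f_lipschitz : forall p : R, exists2 K, 0 <= K &
  forall t, `|t| <= 1 -> `|f t p| <= K /\
    forall t', `|t'| <= 1 -> `|f t' p - f t p| <= K * `|t' - t|.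
Variables (n N : nat) (H : 'I_n -> {mpoly R[n]}).
Variables (D : nat) (M : {mpoly R[n]} -> 'M[R]_D).
Hypothesis HM : multiplication_table N H M.

Let spec t p : 'M[C]_D := map_mx (f t) (M p).
Local Notation ev t x := (mmap (f t) x).
Local Open Scope sesquilinear_scope.

Fact spec_mul t p q : spec t (p * q) = spec t p *m spec t q.
Proof. by rewrite /spec (table_mul HM) map_mxM. Qed.

Fact spec_linear t c p q : spec t (c *: p + q) = f t c *: spec t p + spec t q.
Proof. by rewrite /spec (table_linear HM) map_mxD map_mxZ. Qed.

Fact spec_one t : spec t 1 = 1%:M.
Proof. by rewrite /spec (table_one HM) map_mx1. Qed.

(** The multiplications commute, so they can be triangularized together.  Reading
    a given diagonal position is then a ring morphism, that is, the evaluation at a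
    point, and it kills the [H i]. *)
Lemma diagonal_zeros t : exists (U : 'M[C]_D) (z : 'I_D -> 'I_n -> C),
  [/\ U \is unitarymx,
      forall p, is_trig_mx (U *m spec t p *m U^t* ),
      forall p k, (U *m spec t p *m U^t* ) k k = ev t (z k) p &
      forall k i, ev t (z k) (H i) = 0].
Proof.
pose As := [seq spec t 'X_i | i : 'I_n].
have [|U Uu /allP Utrig] := @cotrigonalization C _ As.
  move=> _ _ /mapP[j _ ->] /mapP[k _ ->].
  by rewrite /comm_mx -!spec_mul mulrC.
pose conj p := U *m spec t p *m U^t*.
have conjM p q : conj (p * q) = conj p *m conj q.
  rewrite /conj spec_mul !mulmxA; congr (_ *m _ *m _).
  by rewrite mulmxKtV.
have conjP c p q : conj (c *: p + q) = f t c *: conj p + conj q.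
  by rewrite /conj spec_linear mulmxDr mulmxDl -scalemxAr -scalemxAl.
have conj1 : conj 1 = 1%:M by rewrite /conj spec_one mulmx1; apply/unitarymxP.
have conj0 : conj 0 = 0.
  rewrite -[0 in LHS](addNr 0) -[X in X + _]scaleN1r conjP.
  by rewrite rmorphN1 scaleN1r addNr.
pose z k i := conj 'X_i k k.
pose good p := is_trig_mx (conj p) /\ forall k, conj p k k = ev t (z k) p.
have goodM p q : good p -> good q -> good (p * q).
  move=> [pt pd] [qt qd]; split; first by rewrite conjM is_trig_mxM.
  by move=> k; rewrite conjM trig_mxM_diag // pd qd rmorphM.
have goodX i : good 'X_i.
  split; last by move=> k; rewrite mmapX mmap1U.
  have /Utrig : spec t 'X_i \in As by apply/mapP; exists i; rewrite ?mem_enum.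
  by rewrite /= /similar_to conjymx.
have good1 : good 1.
  split; last by move=> k; rewrite conj1 mxE eqxx -mpolyC1 mmapC; apply/esym/(rmorph1 (f t)).
  by rewrite conj1; apply/is_trig_mxP => i j ij; rewrite mxE -val_eqE ltn_eqF.
have goodP p : good p.
  elim/mpolyind: p => [|c m p _ _ [pt pd]].
    by split; rewrite conj0 ?mx0_is_trig // => k; rewrite mxE rmorph0.
  have [mt md] : good 'X_[m].
    rewrite mpolyXE_id; elim/big_ind: _ => // i _.
    by elim: (m i) => [//|k IH]; rewrite exprS; apply: goodM.
  split; first by rewrite conjP is_trig_mxD // is_trig_mxZ.
  by move=> k; rewrite conjP [LHS]mxE [X in X + _]mxE md pd mmapD mmapZ.
exists U, z; split=> // [p|p k|k i]; try by case: (goodP p).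
have [_ <-] := goodP (H i).
by rewrite /conj /spec (table_rel HM) map_mx0 mulmx0 mul0mx mxE.
Qed.

(** The joint eigenvector given by a zero at [t] is an approximate one at [t'].  By
    [trig_approx_kernel], after triangularization some diagonal position is close
    to the zero in all the variables at once, and it carries a zero at [t'].  The
    estimates are uniform because the change of basis is unitary. *)
Lemma zeros_continuous (b rho : C) : 0 <= b -> 0 < rho ->
  exists2 e : C, 0 < e & forall t t' (x : 'I_n -> C),
    `|t| <= 1 -> `|t'| <= 1 -> `|t' - t| <= e ->
    (forall i, `|x i| <= b) -> (forall i, ev t x (H i) = 0) ->
    exists2 x', (forall i, ev t' x' (H i) = 0) & forall i, `|x' i - x i| <= rho.
Proof.
move=> b0 rho0.
have [K K0 KP] : exists2 K : C, 0 <= K & forall s : 'I_n * ('I_D * 'I_D),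
    forall t, `|t| <= 1 -> `|spec t 'X_s.1 s.2.1 s.2.2| <= K /\
    forall t', `|t'| <= 1 ->
      `|spec t' 'X_s.1 s.2.1 s.2.2 - spec t 'X_s.1 s.2.1 s.2.2| <= K * `|t' - t|.
  apply: uniform_bound => [s K K' KK' + t t1|s].
    move=> /(_ t t1) /= [h1 h2]; split=> [|t' t'1]; first exact: le_trans KK'.
    by apply: le_trans (h2 t' t'1) _; rewrite ler_wpM2r.
  have [K K0 KP] := f_lipschitz (M 'X_s.1 s.2.1 s.2.2); exists K => // t t1.
  have [h1 h2] := KP t t1; rewrite !mxE; split=> // t' t'1.
  by rewrite mxE; apply: h2.
pose V := (1 + b) ^+ (n * N).
pose d : C := D%:R.
have d0 : 0 <= d by rewrite ler0n.
have d10 : 0 < d + 1 by rewrite ltr_wpDl.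
have V0 : 0 <= V by rewrite exprn_ge0 // addr_ge0.
have [|||e0 e00 He] := @trig_approx_kernel D (d * (d * (K + b))) (d + 1)^-1 rho.
- by rewrite !mulr_ge0 // addr_ge0.
- by rewrite invr_gt0.
- by [].
pose e := e0 / (d * (d * (K * V)) + 1).
have den : 0 < d * (d * (K * V)) + 1 by rewrite ltr_wpDl // !mulr_ge0.
exists e; first by rewrite divr_gt0.
move=> t t' x t1 t'1 tt' xb Hx.
have [U [z [Uu Utrig Udiag Hz]]] := diagonal_zeros t'.
have [v [[k0 vk0] vmono veig]] := table_eigen HM Hx.
have vV k : `|v k ord0| <= V.
  have [a aN ->] := vmono k.
  rewrite normr_prod /V mulnC exprM.
  rewrite -[X in _ ^+ X]card_ord -prodr_const.
  apply: ler_prod => i _; rewrite normr_ge0 normrX /=.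
  apply: le_trans (_ : (1 + b) ^+ a i <= _).
    by rewrite lerXn2r ?nnegrE ?addr_ge0 // (le_trans (xb i)) // lerDr.
  by apply: ler_weXn2l; [rewrite lerDl | apply: ltnW].
pose w := U *m v.
have UVt : U^t* *m U = 1%:M.
  by apply/mulmx1C/unitarymxP.
(* [U] preserves the size of vectors up to the dimension, and [v] has an entry
   equal to [1]: that of the constant monomial. *)
have w_big : exists k, (d + 1)^-1 <= `|w k ord0|.
  apply/existsP; apply/negbNE/negP; rewrite negb_exists => /forallP wsmall.
  have : v k0 ord0 = \sum_k (U^t* ) k0 k * w k ord0.
    by rewrite -[v in LHS]mul1mx -UVt -mulmxA mxE.
  move=> /(congr1 Num.norm); rewrite vk0 normr1 => sum1.
  have : `|\sum_k (U^t* ) k0 k * w k ord0| <= D%:R * (d + 1)^-1.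
    apply: norm_sum_le => k.
    rewrite normrM -[leRHS]mul1r.
    have U1 : `|(U^t* ) k0 k| <= 1 by rewrite unitarymx_entry // trmxC_unitary.
    apply: ler_pM => //; rewrite ltW // real_ltNge ?wsmall //.
    by rewrite realE invr_ge0 (ltW d10).
  by rewrite -sum1 ler_pdivlMr // mul1r -/d gerDl ler10.
(* [v] is a joint eigenvector at [t], so it is nearly killed by the matrices
   [B j] built from the same eigenvalues at [t']. *)
pose B (j : 'I_n) := spec t' 'X_j - x j *: 1%:M.
pose T (j : 'I_n) := U *m B j *m U^t*.
have TE j : T j = U *m spec t' 'X_j *m U^t* + (- x j) *: 1%:M.
  rewrite /T /B mulmxBr mulmxBl -scalemxAr mulmx1 -scalemxAl.
  by rewrite (unitarymxP Uu) scaleNr.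
have conj_small (A : 'M[C]_D) c : (forall k l, `|A k l| <= c) ->
    forall k l, `|(U *m A *m U^t* ) k l| <= d * (d * c).
  move=> Ac k l; rewrite mxE; apply: norm_sum_le => i.
  rewrite normrM -[leRHS]mulr1 ler_pM // ?unitarymx_entry ?trmxC_unitary //.
  rewrite mxE; apply: norm_sum_le => i'.
  by rewrite normrM -[leRHS]mul1r ler_pM // unitarymx_entry.
have [||||k Hk] := He 'I_n T w.
- move=> j; rewrite TE; apply: is_trig_mxD (Utrig _) _; apply: is_trig_mxZ.
  by apply/is_trig_mxP => k l kl; rewrite mxE -val_eqE ltn_eqF.
- move=> j; apply: conj_small => k l; rewrite /B !mxE.
  apply: le_trans (ler_normB _ _) _; apply: lerD.
    by have [] := KP (j, (k, l)) t' t'1; rewrite mxE.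
  rewrite normrM -[leRHS]mulr1 ler_pM //.
  by case: eqP; rewrite ?normr1 ?normr0.
- exact: w_big.
- move=> j k.
  have -> : T j *m w = U *m ((spec t' 'X_j - spec t 'X_j) *m v).
    rewrite /T /B /w -!mulmxA (mulmxA _ U v) UVt mul1mx !mulmxBl veig.
    by rewrite -scalemxAl mul1mx mmapX mmap1U.
  apply: le_trans (_ : d * (d * (K * V)) * e <= e0); last first.
    rewrite /e mulrCA ler_piMr ?(ltW e00) // ler_pdivrMr // mul1r lerDl.
    exact: ler01.
  rewrite mxE -!mulrA; apply: norm_sum_le => i.
  rewrite normrM -[leRHS]mul1r ler_pM // ?unitarymx_entry //.
  rewrite mxE; apply: norm_sum_le => l.
  rewrite normrM [V * e]mulrC mulrA ler_pM // !mxE.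
  have [_ /(_ t' t'1)] := KP (j, (i, l)) t t1; rewrite !mxE.
  by move=> /le_trans; apply; rewrite ler_wpM2l.
exists (z k) => // j.
by have := Hk j; rewrite TE mxE Udiag !mxE eqxx mulr1 mmapX mmap1U.
Qed.

End Zeros.
End Approximation.

(** * Following a zero along a homotopy *)

Lemma meval_sum_exists (K : comNzRingType) n (p q : {mpoly K[n]}) :
  exists r : {mpoly K[n]}, forall x, r.@[x] = p.@[x] + q.@[x].
Proof. by exists (p + q) => x; rewrite mevalD. Qed.

Section Homotopy.
Variable C : numClosedFieldType.
Hypothesis archi : forall e : C, 0 < e -> exists m : nat, m.+1%:R^-1 <= e.

Definition sqnorm n (x : 'I_n -> C) := \sum_i `|x i| ^+ 2.

Lemma sqnorm_ge0 n (x : 'I_n -> C) : 0 <= sqnorm x.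
Proof. by apply: sumr_ge0 => i _; rewrite exprn_ge0. Qed.

Lemma sqnorm_ge n (x : 'I_n -> C) i : `|x i| ^+ 2 <= sqnorm x.
Proof.
by rewrite /sqnorm (bigD1 i) //= lerDl sumr_ge0 // => j _; rewrite exprn_ge0.
Qed.

Lemma sqnorm_le_entry n (x : 'I_n -> C) d i :
  0 <= d -> sqnorm x <= d ^+ 2 -> `|x i| <= d.
Proof.
move=> d0 xd; rewrite -(@ler_pXn2r _ 2) ?nnegrE //.
exact: le_trans (sqnorm_ge x i) xd.
Qed.

Lemma sqnorm_near n (x y : 'I_n -> C) d : 0 < d -> sqnorm x <= d ^+ 2 ->
  (forall i, `|y i - x i| <= d / n.+1%:R) -> sqnorm y <= (2%:R * d) ^+ 2.
Proof.
move=> d0 xd yx; have dn0 : 0 <= d / n.+1%:R by rewrite divr_ge0 ?ltW // ltr0n.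
have le2 i : `|y i| ^+ 2 <= 2%:R * `|x i| ^+ 2 + 2%:R * (d / n.+1%:R) ^+ 2.
  have yi : `|y i| <= `|x i| + d / n.+1%:R.
    rewrite -[y i](subrK (x i)) addrC; apply: le_trans (ler_normD _ _) _.
    by rewrite lerD2l.
  apply: le_trans (_ : (`|x i| + d / n.+1%:R) ^+ 2 <= _).
    by rewrite lerXn2r ?nnegrE // addr_ge0.
  rewrite -subr_ge0; set a := `|x i|; set b := d / _.
  have -> : 2%:R * a ^+ 2 + 2%:R * b ^+ 2 - (a + b) ^+ 2 = (a - b) ^+ 2 by ring.
  by rewrite real_exprn_even_ge0 // rpredB // realE ?normr_ge0 ?dn0.
apply: le_trans (ler_sum _ (fun i _ => le2 i)) _.
rewrite big_split /= -mulr_sumr sumr_const card_ord.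
rewrite (_ : (2%:R * d) ^+ 2 = 2%:R * d ^+ 2 + 2%:R * d ^+ 2); last by ring.
apply: lerD; first by rewrite ler_pM2l ?ltr0n.
rewrite -mulrnAr ler_pM2l ?ltr0n // expr_div_n -mulr_natr -mulrA.
rewrite ler_piMr ?exprn_ge0 ?(ltW d0) // mulrC ler_pdivrMr ?exprn_gt0 ?ltr0n //.
by rewrite mul1r -natrX ler_nat; lia.
Qed.

Variables (n N : nat) (F G : 'I_n -> {mpoly C[n]}).
Hypothesis N_gt0 : (0 < N)%N.
Hypothesis msizeF : forall i, (msize (F i) <= N)%N.
Hypothesis msizeG : forall i, (msize (G i) <= N)%N.

Lemma msize_map_polyC (p : {mpoly C[n]}) :
  (msize (map_mpoly (@polyC C) p) <= msize p)%N.
Proof.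
rewrite [X in (X <= _)%N]msizeE; apply/bigmax_leqP_seq => m.
rewrite mcoeff_msupp mcoeff_map_mpoly polyC_eq0 -mcoeff_msupp => mp _.
exact: msize_mdeg_lt.
Qed.

Lemma mmap_map_polyC t (x : 'I_n -> C) (p : {mpoly C[n]}) :
  mmap (horner_eval t) x (map_mpoly (@polyC C) p) = p.@[x].
Proof.
elim/mpolyind: p => [|c m p _ _ IH]; first by rewrite !rmorph0.
rewrite !rmorphD /= IH map_mpolyZ map_mpolyX mmapZ mmapX mevalZ mevalX.
by rewrite /= /horner_eval hornerC.
Qed.

(** The family [s *: 'X_i ^+ N + F i + t *: G i] has no zeros at infinity, so no
    zero is lost when [t] moves; as none crosses the shell around the origin,
    the zero at the origin for [t = 0] gives one inside the shell for [t = 1]. *)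
Lemma zero_in_ball (s d : C) : s != 0 -> 0 < d -> (forall i, (F i).@[fun=> 0] = 0) ->
  (forall t (x : 'I_n -> C), `|t| <= 1 ->
    d ^+ 2 <= sqnorm x -> sqnorm x <= (2%:R * d) ^+ 2 ->
    ~ forall i, s * x i ^+ N + (F i).@[x] + t * (G i).@[x] = 0) ->
  exists2 x : 'I_n -> C, sqnorm x < d ^+ 2 &
    forall i, s * x i ^+ N + (F i).@[x] + (G i).@[x] = 0.
Proof.
move=> s0 d0 F0 shell.
pose L i : {mpoly {poly C}[n]} :=
  s^-1%:P *: (map_mpoly (@polyC C) (F i) + 'X *: map_mpoly (@polyC C) (G i)).
have LN i : (msize (L i) <= N)%N.
  apply: leq_trans (msizeZ_le _ _) _; apply: leq_trans (msizeD_le _ _) _.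
  rewrite geq_max (leq_trans (msize_map_polyC _)) //=.
  by apply: leq_trans (msizeZ_le _ _) _; apply: leq_trans (msize_map_polyC _) _.
have [D [M HM]] := multiplication_table_exists N_gt0 LN.
have evH t x i : mmap (horner_eval t) x ('X_i ^+ N + L i) =
    s^-1 * (s * x i ^+ N + (F i).@[x] + t * (G i).@[x]).
  rewrite rmorphD rmorphXn /= mmapX mmap1U mmapZ mmapD mmapZ.
  rewrite !mmap_map_polyC /= /horner_eval hornerC hornerX.
  by rewrite -addrA [RHS]mulrDr mulKf.
have Hlip (p : {poly C}) : exists2 K, 0 <= K &
    forall t, `|t| <= 1 -> `|horner_eval t p| <= K /\
    forall t', `|t'| <= 1 ->
      `|horner_eval t' p - horner_eval t p| <= K * `|t' - t|.
  exact: horner_lipschitz.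
have rho0 : 0 < d / n.+1%:R by rewrite divr_gt0 ?ltr0n.
have [e e0 He] := zeros_continuous (f := fun t => horner_eval t : {rmorphism {poly C} -> C})
    Hlip HM (ltW d0) rho0.
have [m me] := archi e0.
pose t k : C := k%:R / m.+1%:R.
have t01 k : (k <= m.+1)%N -> `|t k| <= 1.
  move=> km; rewrite ger0_norm ?divr_ge0 ?ler0n //.
  by rewrite ler_pdivrMr ?ltr0n // mul1r ler_nat.
(* Each step is short enough to stay inside the outer sphere of the shell. *)
have step k : (k <= m.+1)%N -> exists2 x : 'I_n -> C, sqnorm x < d ^+ 2 &
    forall i, s * x i ^+ N + (F i).@[x] + t k * (G i).@[x] = 0.
  elim: k => [_|k IH km].
    exists (fun=> 0).
      rewrite /sqnorm big1 ?exprn_gt0 // => i _.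
      by rewrite normr0 expr0n.
    by move=> i; rewrite /t !mul0r F0 expr0n gtn_eqF // mulr0 !addr0.
  have [x xd Hx] := IH (ltnW km).
  have [|||||y Hy yx] := He (t k) (t k.+1) x.
  - exact/t01/ltnW.
  - exact: t01.
  - apply: le_trans me; rewrite -mulrBl -natrB // subSnn mul1r.
    by rewrite ger0_norm // invr_ge0 ler0n.
  - by move=> i; apply: sqnorm_le_entry; rewrite ltW.
  - by move=> i; rewrite evH Hx mulr0.
  have Hy' i : s * y i ^+ N + (F i).@[y] + t k.+1 * (G i).@[y] = 0.
    have /eqP := Hy i; rewrite evH mulf_eq0 invr_eq0 (negPf s0) /=.
    by move/eqP.
  exists y => //.
  rewrite real_ltNge ?realE ?sqnorm_ge0 ?exprn_ge0 ?(ltW d0) //.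
  apply/negP => dy; apply: shell dy _ Hy'; first exact: t01.
  exact: sqnorm_near (ltW xd) yx.
have [x xd Hx] := step m.+1 (leqnn _); exists x => // i.
by have := Hx i; rewrite /t divff ?pnatr_eq0 // mul1r.
Qed.

End Homotopy.

Lemma exists_homotopy_degree (C : numClosedFieldType) n (F G : 'I_n -> {mpoly C[n]}) :
  (forall e : C, 0 < e -> exists m : nat, m.+1%:R^-1 <= e) ->
  (forall i, (F i).@[fun=> 0] = 0) ->
  exists N : nat, forall s d : C, s != 0 -> 0 < d ->
  (forall t (x : 'I_n -> C), `|t| <= 1 ->
    d ^+ 2 <= sqnorm x -> sqnorm x <= (2%:R * d) ^+ 2 ->
    ~ forall i, s * x i ^+ N + (F i).@[x] + t * (G i).@[x] = 0) ->
  exists2 x : 'I_n -> C, sqnorm x < d ^+ 2 &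
    forall i, s * x i ^+ N + (F i).@[x] + (G i).@[x] = 0.
Proof.
move=> archi F0; pose N := (\sum_i (msize (F i) + msize (G i))).+1.
have FN i : (msize (F i) <= N)%N.
  by rewrite /N (bigD1 i) //= -!addnA leqW // leq_addr.
have GN i : (msize (G i) <= N)%N.
  by rewrite /N (bigD1 i) //= -addnA addnCA leqW // leq_addr.
exists N => s d s0 d0; exact: zero_in_ball.
Qed.

(** * Polynomials with varying coefficients *)

Lemma meval_scale_exists (K : comNzRingType) n c (p : {mpoly K[n]}) :
  exists r : {mpoly K[n]}, forall x, r.@[x] = c * p.@[x].
Proof. by exists (c *: p) => x; rewrite mevalZ. Qed.

Lemma meval_bounded (C : numClosedFieldType) n (p : {mpoly C[n]}) (b : C) :
  0 <= b -> exists2 K, 0 <= K & forall x, (forall i, `|x i| <= b) -> `|p.@[x]| <= K.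
Proof.
move=> b0; exists (\sum_(m <- msupp p) `|p@_m| * \prod_i b ^+ m i) => [|x xb].
  by apply: sumr_ge0 => m _; rewrite mulr_ge0 ?prodr_ge0 // => i _; rewrite exprn_ge0.
rewrite mevalE; apply: le_trans (ler_norm_sum _ _ _) _; apply: ler_sum => m _.
rewrite normrM ler_wpM2l // normr_prod; apply: ler_prod => i _.
by rewrite normr_ge0 normrX lerXn2r ?nnegrE.
Qed.

Section PolynomialFamilies.
Variables (K : comNzRingType) (n : nat).
Implicit Types g h : ('I_n -> K) -> {poly K}.

(** Stated for functions of the parameters, so that the equations can be written
    over [K] itself rather than for generic coefficients. *)
Definition poly_family g :=
  exists P : {poly {mpoly K[n]}}, forall x, g x = map_poly (meval x) P.

Lemma poly_family_const c : poly_family (fun=> c).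
Proof.
exists (map_poly (@mpolyC n K) c) => x; rewrite -map_poly_comp.
by rewrite map_poly_id // => y _ /=; rewrite mevalC.
Qed.

Lemma poly_family_var i : poly_family (fun x => (x i)%:P).
Proof. by exists ('X_i)%:P => x; rewrite map_polyC /= mevalXU. Qed.

Lemma poly_familyD g h : poly_family g -> poly_family h ->
  poly_family (fun x => g x + h x).
Proof. by move=> [P gP] [Q hQ]; exists (P + Q) => x; rewrite gP hQ rmorphD. Qed.

Lemma poly_familyB g h : poly_family g -> poly_family h ->
  poly_family (fun x => g x - h x).
Proof. by move=> [P gP] [Q hQ]; exists (P - Q) => x; rewrite gP hQ rmorphB. Qed.

Lemma poly_familyM g h : poly_family g -> poly_family h ->
  poly_family (fun x => g x * h x).
Proof. by move=> [P gP] [Q hQ]; exists (P * Q) => x; rewrite gP hQ rmorphM. Qed.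

Lemma poly_familyX g k : poly_family g -> poly_family (fun x => g x ^+ k).
Proof. by move=> [P gP]; exists (P ^+ k) => x; rewrite gP rmorphXn. Qed.

Lemma poly_family_deriv g : poly_family g -> poly_family (fun x => (g x)^`()).
Proof. by move=> [P gP]; exists (P^`()) => x; rewrite gP deriv_map. Qed.

Lemma poly_family_sum (I : finType) (g : I -> ('I_n -> K) -> {poly K}) :
  (forall i, poly_family (g i)) -> poly_family (fun x => \sum_i g i x).
Proof.
move=> /fin_all_exists [P gP]; exists (\sum_i P i) => x.
by rewrite rmorph_sum; apply: eq_bigr => i _; rewrite gP.
Qed.

Lemma poly_family_prod (I : finType) (p : pred I)
    (g : I -> ('I_n -> K) -> {poly K}) :
  (forall i, poly_family (g i)) -> poly_family (fun x => \prod_(i | p i) g i x).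
Proof.
move=> /fin_all_exists [P gP]; exists (\prod_(i | p i) P i) => x.
by rewrite rmorph_prod; apply: eq_bigr => i _; rewrite gP.
Qed.

Lemma poly_family_coef g k : poly_family g ->
  exists p : {mpoly K[n]}, forall x, p.@[x] = (g x)`_k.
Proof. by move=> [P gP]; exists P`_k => x; rewrite gP coef_map. Qed.

End PolynomialFamilies.

End PolynomialSystems.

(** * Monic polynomials *)

Section Monic.
Variable K : fieldType.
Implicit Types p q : {poly K}.

(** A monic polynomial is either [1] or not invertible, and the inverse of a
    ring element that is not invertible is by convention that element. *)
Lemma monic_invr p : p \is monic -> p^-1 = p.
Proof.
move=> pm; have [|nu] := boolP (p \is a GRing.unit); last exact: invr_out.
rewrite poly_unitE => /andP[/eqP p1 _]; have pC := size1_polyC (eq_leq p1).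
move: pm; rewrite pC monicE lead_coefC => /eqP ->; exact: invr1.
Qed.

(** Hence the right-hand sides of the equations are polynomial in the coefficients
    of the unknown monic polynomials. *)
Lemma monic_exprz p (k : int) : p \is monic -> p ^ (- k) = p ^+ `|k|%N.
Proof.
move=> pm; case: k => k; last by rewrite NegzE opprK.
by rewrite absz_nat -exprnN monic_invr // monic_exp.
Qed.

Definition same_monic p q := [/\ p \is monic, q \is monic & size p = size q].

Lemma same_monicM p q p' q' :
  same_monic p q -> same_monic p' q' -> same_monic (p * p') (q * q').
Proof.
move=> [pm qm pq] [pm' qm' pq']; split; rewrite ?monicMl //.
by rewrite !size_monicM ?monic_neq0 // pq pq'.
Qed.

Lemma same_monicX p q k : same_monic p q -> same_monic (p ^+ k) (q ^+ k).
Proof.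
move=> pq; elim: k => [|k IH]; first by rewrite !expr0; split; rewrite ?monic1.
by rewrite !exprS; apply: same_monicM.
Qed.

Lemma size_Wronskian p q : p != 0 -> q != 0 ->
  (size (Wronskian p q) < (size p + size q).-1)%N.
Proof.
move=> p0 q0; rewrite /Wronskian.
have hp := lt_size_deriv p0; have hq := lt_size_deriv q0.
have h1 := size_polyMleq p q^`(); have h2 := size_polyMleq q p^`().
apply: leq_ltn_trans (size_polyD _ _) _; rewrite size_polyN gtn_max.
rewrite (leq_ltn_trans h1) ?(leq_ltn_trans h2) //.
  by move: hp hq; clear; lia.
by move: hp hq; clear; lia.
Qed.

Section ShiftCoefs.
Variables (q : {poly K}) (k : nat).

Definition shift_coefs (c : 'I_k -> K) := q + \sum_j (c j)%:P * 'X^j.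

Lemma size_low_part (c : 'I_k -> K) : (size (\sum_j (c j)%:P * 'X^j)%R <= k)%N.
Proof.
apply: leq_trans (size_sum _ _ _) _; apply/bigmax_leqP => j _.
rewrite mul_polyC; apply: leq_trans (size_scale_leq _ _) _.
by rewrite size_polyXn.
Qed.

Lemma coef_shift_lt c (j : 'I_k) : (shift_coefs c)`_j = q`_j + c j.
Proof.
rewrite coefD coef_sum (bigD1 j) //= big1 => [|l lj].
  by rewrite coefCM coefXn eqxx mulr1 addr0.
by rewrite coefCM coefXn eq_sym (inj_eq val_inj) (negPf lj) mulr0.
Qed.

Lemma coef_shift_ge c j : (k <= j)%N -> (shift_coefs c)`_j = q`_j.
Proof.
move=> kj; rewrite coefD [X in _ + X]nth_default ?addr0 //.
exact: leq_trans (size_low_part c) kj.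
Qed.

Lemma same_monic_shift c : size q = k.+1 -> q \is monic ->
  same_monic (shift_coefs c) q.
Proof.
move=> qk qm; have lt : (size (\sum_j (c j)%:P * 'X^j)%R < size q)%N.
  by rewrite qk ltnS size_low_part.
by split=> //; rewrite ?size_polyDl // monicE lead_coefDl.
Qed.

End ShiftCoefs.
End Monic.

(** * Compactness *)

From mathcomp Require Import all_classical all_reals topology normedtype derive.
Import numFieldNormedType.Exports.
Import PolynomialSystems.

Local Notation meval := mpoly.meval.

Section Compactness.
Local Open Scope classical_set_scope.
Variables (R : realType) (n : nat).
Local Notation C := R[i].

(** Complex points in real coordinates, where closed bounded sets are compact. *)
Definition cpoint (v : 'rV[R]_(n + n)) (i : 'I_n) : C :=
  (v ord0 (lshift n i) +i* v ord0 (rshift n i))%C.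

Lemma cpoint_surj x : exists v, cpoint v = x.
Proof.
exists (row_mx (\row_i complex.Re (x i)) (\row_i complex.Im (x i))).
apply/funext => i; rewrite /cpoint row_mxEl row_mxEr !mxE.
by case: (x i).
Qed.

Lemma normc_sqr (z : C) :
  `|z| ^+ 2 = (complex.Re z ^+ 2 + complex.Im z ^+ 2)%:C%C.
Proof.
by rewrite normc_def -rmorphXn /= sqr_sqrtr // addr_ge0 ?sqr_ge0.
Qed.

Definition cpoint_sqnorm (v : 'rV[R]_(n + n)) : R :=
  \sum_i (v ord0 (lshift n i) ^+ 2 + v ord0 (rshift n i) ^+ 2).

Lemma sqnorm_cpoint v : sqnorm (cpoint v) = (cpoint_sqnorm v)%:C%C.
Proof. by rewrite /sqnorm rmorph_sum /=; apply: eq_bigr => i _; rewrite normc_sqr. Qed.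

Lemma continuous_sqr_sum (T : topologicalType) k (f g : 'I_k -> T -> R) :
  (forall i, continuous (f i)) -> (forall i, continuous (g i)) ->
  continuous (fun v => \sum_i (f i v ^+ 2 + g i v ^+ 2)).
Proof.
move=> fc gc; apply: continuous_big => [|i _ v]; first exact: add_continuous.
by apply: cvgD; apply: cvgM; [exact: fc|exact: fc|exact: gc|exact: gc].
Qed.

Lemma continuous_cpoint_sqnorm : continuous cpoint_sqnorm.
Proof. by apply: continuous_sqr_sum => i; apply: coord_continuous. Qed.

(** Real and imaginary parts are treated together, because those of a product
    involve both parts of the factors. *)
Lemma continuous_meval (p : mpoly.mpoly n C) :
  continuous (fun v => complex.Re (meval (cpoint v) p)) /\
  continuous (fun v => complex.Im (meval (cpoint v) p)).
Proof.
pose good (g : 'rV[R]_(n + n) -> C) :=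
  continuous (fun v => complex.Re (g v)) /\ continuous (fun v => complex.Im (g v)).
have goodD g h : good g -> good h -> good (fun v => g v + h v).
  move=> [g1 g2] [h1 h2]; split=> v.
    rewrite [X in continuous_at _ X](_ : _ = fun v => complex.Re (g v) + complex.Re (h v)).
      exact: cvgD (g1 v) (h1 v).
    by apply/funext => u /=; case: (g u) (h u) => ? ? [].
  rewrite [X in continuous_at _ X](_ : _ = fun v => complex.Im (g v) + complex.Im (h v)).
    exact: cvgD (g2 v) (h2 v).
  by apply/funext => u /=; case: (g u) (h u) => ? ? [].
have goodM g h : good g -> good h -> good (fun v => g v * h v).
  move=> [g1 g2] [h1 h2]; split=> v.
    rewrite [X in continuous_at _ X](_ : _ = fun v => complex.Re (g v) * complex.Re (h v) -
      complex.Im (g v) * complex.Im (h v)).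
      exact: cvgB (cvgM (g1 v) (h1 v)) (cvgM (g2 v) (h2 v)).
    by apply/funext => u /=; case: (g u) (h u) => ? ? [].
  rewrite [X in continuous_at _ X](_ : _ = fun v => complex.Re (g v) * complex.Im (h v) +
      complex.Im (g v) * complex.Re (h v)).
    exact: cvgD (cvgM (g1 v) (h2 v)) (cvgM (g2 v) (h1 v)).
  by apply/funext => u /=; case: (g u) (h u) => ? ? [].
have goodC c : good (fun=> c) by split; apply: cst_continuous.
have goodX i : good (cpoint ^~ i).
  split; [exact: (@coord_continuous R _ _ ord0 (lshift n i)) |
          exact: (@coord_continuous R _ _ ord0 (rshift n i))].
suff : good (fun v => (meval (cpoint v) p)) by [].
elim/mpoly.mpolyind: p => [|c m p _ _ IH].
  rewrite (_ : (fun v => _) = fun=> 0) //.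
  by apply/funext => v; rewrite mpoly.meval0.
rewrite (_ : (fun v => _) = fun v =>
    c * (\prod_i (cpoint v i) ^+ mpoly.fun_of_multinom m i) + (meval (cpoint v) p)).
  apply: (goodD _ _ _ IH); apply: (goodM _ _ (goodC c)).
  have : forall s : seq 'I_n, good (fun v => \prod_(i <- s) cpoint v i ^+ mpoly.fun_of_multinom m i).
    elim=> [|i s IHs].
      by rewrite (_ : (fun v => _) = fun=> 1) //; apply/funext => v; rewrite big_nil.
    rewrite (_ : (fun v => _) = fun v => (cpoint v i ^+ mpoly.fun_of_multinom m i) *
      (\prod_(i <- s) cpoint v i ^+ mpoly.fun_of_multinom m i)); last first.
      by apply/funext => v; rewrite big_cons.
    apply: (goodM _ _ _ IHs); elim: (mpoly.fun_of_multinom m i) => [|k IHk].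
      by rewrite (_ : (fun v => _) = fun=> 1).
    rewrite (_ : (fun v => _) = fun v => cpoint v i * cpoint v i ^+ k).
      exact: goodM.
    by apply/funext => v; rewrite exprS.
  exact.
by apply/funext => v; rewrite mpoly.mevalD mpoly.mevalZ mpoly.mevalX.
Qed.

Lemma exists_minimum (f : 'rV[R]_(n + n) -> R) (A : set 'rV[R]_(n + n)) b :
  continuous f -> closed A -> (forall v, A v -> cpoint_sqnorm v <= b) ->
  A !=set0 -> exists2 v, A v & forall u, A u -> f v <= f u.
Proof.
move=> fc Acl Ab A0.
have Acomp : compact A.
  apply: bounded_closed_compact => //.
  exists (1 + b); split; first exact: num_real.
  move=> M bM v Av; apply: le_trans (ltW bM).
  have vb := Ab v Av.
  have b0 : 0 <= b.
    by apply: le_trans vb; apply: sumr_ge0 => i _; rewrite addr_ge0 ?sqr_ge0.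
  have entry (k : 'I_(n + n)) : `|v ord0 k| <= 1 + b.
    rewrite -(@ler_pXn2r _ 2) ?nnegrE ?addr_ge0 // real_normK ?num_real //.
    apply: le_trans (_ : b <= _); last first.
      by rewrite sqrrD expr1n mul1r; nra.
    apply: le_trans vb; rewrite /cpoint_sqnorm.
    case: (split_ordP k) => i ->; rewrite (bigD1 i) //=.
      rewrite -addrA lerDl addr_ge0 ?sqr_ge0 //.
      by apply: sumr_ge0 => j _; rewrite addr_ge0 ?sqr_ge0.
    rewrite [X in X + _]addrC -addrA lerDl addr_ge0 ?sqr_ge0 //.
    by apply: sumr_ge0 => j _; rewrite addr_ge0 ?sqr_ge0.
  rewrite [leLHS]/Num.Def.normr /= mx_normrE; apply: bigmax_le => [|[k l] _ /=].
    by rewrite addr_ge0.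
  by rewrite ord1.
have [v vA fv] := compact_EVT_min A0 Acomp (continuous_subspaceT fc).
by exists v => [|u uA]; [exact: set_mem|apply/fv/mem_set].
Qed.

(** The sum of the squared moduli attains a positive minimum on the closed shell,
    and one of the terms has to account for a fixed share of it. *)
Lemma exists_pos_lower_bound (a b : R) m (F : 'I_m -> mpoly.mpoly n C) :
  (forall x, a%:C%C <= sqnorm x -> sqnorm x <= b%:C%C ->
     exists i, meval x (F i) != 0) ->
  exists2 c : C, 0 < c & forall x, a%:C%C <= sqnorm x -> sqnorm x <= b%:C%C ->
     exists i, c <= `|meval x (F i)|.
Proof.
move=> F0.
pose A := [set v | a <= cpoint_sqnorm v] `&` [set v | cpoint_sqnorm v <= b].
have Acl : closed A.
  apply: closedI.
    exact: (closed_comp (fun v _ => continuous_cpoint_sqnorm (x := v)) (@closed_ge _ a)).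
  exact: (closed_comp (fun v _ => continuous_cpoint_sqnorm (x := v)) (@closed_le _ b)).
pose f v := \sum_i (complex.Re (meval (cpoint v) (F i)) ^+ 2 +
                    complex.Im (meval (cpoint v) (F i)) ^+ 2).
have fE v : (f v)%:C%C = \sum_i `|meval (cpoint v) (F i)| ^+ 2.
  by rewrite rmorph_sum /=; apply: eq_bigr => i _; rewrite normc_sqr.
have fc : continuous f.
  by apply: continuous_sqr_sum => i; have [] := continuous_meval (F i).
have [A0|A0] := pselect (A !=set0); last first.
  exists 1 => // x xa xb; exfalso; apply: A0.
  have [v vx] := cpoint_surj x.
  by exists v; split=> /=; rewrite -lecR -sqnorm_cpoint vx.
have [v [va vb] vmin] := exists_minimum fc Acl (fun v Av => Av.2) A0.
have fv0 : 0 < f v.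
  rewrite lt_neqAle sumr_ge0 ?andbT => [|i _]; last by rewrite addr_ge0 ?sqr_ge0.
  apply/eqP => fv0.
  have [||i /negP[]] := F0 (cpoint v); rewrite ?sqnorm_cpoint ?lecR //.
  have : \sum_i `|meval (cpoint v) (F i)| ^+ 2 = 0 by rewrite -fE -fv0.
  move=> /eqP; rewrite psumr_eq0 => [/allP /(_ i (mem_index_enum _))|j _].
    by rewrite /= sqrf_eq0 normr_eq0.
  by rewrite exprn_ge0.
pose c := Num.min 1 (f v / m.+1%:R).
have c0 : 0 < c by rewrite lt_min ltr01 divr_gt0 ?ltr0n.
exists c%:C%C; first by rewrite ltcR.
move=> x xa xb; have [u ux] := cpoint_surj x.
have Au : A u by split=> /=; rewrite -lecR -sqnorm_cpoint ux.
apply/existsP; apply/negbNE/negP; rewrite negb_exists => /forallP small.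
have : (f u)%:C%C <= m%:R * (c%:C%C) ^+ 2.
  rewrite fE ux mulr_natl -[X in _ *+ X]card_ord -sumr_const.
  have c0' : 0 <= c%:C%C by rewrite lecR ltW.
  apply: ler_sum => i _; rewrite lerXn2r ?nnegrE // ltW //.
  by rewrite real_ltNge ?normr_real ?small // ger0_real.
rewrite -rmorphXn mulr_natl -rmorphMn lecR /= -mulr_natl => fu.
have cle1 : c <= 1 by rewrite ge_min lexx.
have cle : c <= f v / m.+1%:R by rewrite ge_min lexx orbT.
have := vmin u Au; rewrite leNgt => /negP; apply.
apply: le_lt_trans fu _; apply: lt_le_trans (_ : m.+1%:R * c <= f v).
  rewrite expr2 mulrA ltr_pM2r //.
  apply: (@le_lt_trans _ _ (m%:R * 1)); first by rewrite ler_wpM2l ?ler0n.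
  by rewrite mulr1 ltr_nat.
by rewrite mulrC -ler_pdivlMr ?ltr0n.
Qed.

Lemma exists_min_norm_zero (b : R) m (F : 'I_m -> mpoly.mpoly n C) :
  (exists2 x, sqnorm x <= b%:C%C & forall i, meval x (F i) = 0) ->
  exists x, [/\ sqnorm x <= b%:C%C, forall i, meval x (F i) = 0 &
    forall y, (forall i, meval y (F i) = 0) -> sqnorm x <= sqnorm y].
Proof.
move=> [x0 x0b Fx0].
pose f v := \sum_i (complex.Re (meval (cpoint v) (F i)) ^+ 2 +
                    complex.Im (meval (cpoint v) (F i)) ^+ 2).
have f0 v : f v = 0 <-> forall i, meval (cpoint v) (F i) = 0.
  split=> [/eqP|Fv]; last first.
    by rewrite /f big1 // => i _; rewrite Fv /= expr0n addr0.
  rewrite psumr_eq0 => [/allP h i|i _]; last by rewrite addr_ge0 ?sqr_ge0.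
  have := h i (mem_index_enum _); rewrite /= paddr_eq0 ?sqr_ge0 // !sqrf_eq0.
  by case: (meval _ _) => p q /= /andP[/eqP -> /eqP ->].
have fc : continuous f.
  by apply: continuous_sqr_sum => i; have [] := continuous_meval (F i).
pose A := [set v | f v = 0] `&` [set v | cpoint_sqnorm v <= b].
have Acl : closed A.
  apply: closedI.
    exact: (closed_comp (fun v _ => fc v) (@closed_eq _ 0)).
  exact: (closed_comp (fun v _ => continuous_cpoint_sqnorm (x := v)) (@closed_le _ b)).
have [v0 v0x] := cpoint_surj x0.
have [|v [v1 vb] vmin] :=
    exists_minimum continuous_cpoint_sqnorm Acl (fun v Av => Av.2).
  exists v0; split; first by apply/f0; rewrite v0x.
  by rewrite /= -lecR -sqnorm_cpoint v0x.
exists (cpoint v); split; [by rewrite sqnorm_cpoint lecR|exact/f0|].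
move=> y Fy; have [u uy] := cpoint_surj y; rewrite -uy !sqnorm_cpoint lecR.
have [ub|bu] := leP (cpoint_sqnorm u) b; last exact: le_trans vb (ltW bu).
by apply: vmin; split=> //=; apply/f0; rewrite uy.
Qed.

End Compactness.

(** * Isolated zeros persist *)

Section Perturbation.
Variables (R : realType).
Local Notation C := R[i].

Lemma complex_archi (e : C) : 0 < e -> exists m : nat, m.+1%:R^-1 <= e.
Proof.
move=> e0; have eE : e = (complex.Re e)%:C%C by rewrite RRe_real // gtr0_real.
move: e0; rewrite eE ltcR => r0; set r := complex.Re e in r0 *.
exists (Num.truncn r^-1).
rewrite -(rmorph_nat (real_complex R)) -fmorphV lecR invf_ple ?posrE ?ltr0n //.
by rewrite ltW // truncnS_gt.
Qed.

Lemma exists_smaller (a b : C) : 0 < a -> 0 < b ->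
  exists e, [/\ 0 < e, e < a & e < b].
Proof.
move=> a0 b0; have ab : 0 < a + b by rewrite addr_gt0.
exists (a * b / (a + b)); split; first by rewrite divr_gt0 ?mulr_gt0.
  by rewrite ltr_pdivrMr // ltr_pM2l // ltrDr.
by rewrite ltr_pdivrMr // mulrC ltr_pM2l // ltrDl.
Qed.

(** The homotopy with the terms [s * x i ^+ N] gives near zeros of [F + G] for every
    small [s]; if [F + G] had no zero in the closed ball, it would be bounded
    below there by compactness, which a small [s] contradicts. *)
Lemma perturbed_zero n (F : 'I_n -> mpoly.mpoly n C) (d : R) : 0 < d ->
  (forall i, meval (fun=> 0) (F i) = 0) ->
  (forall x, (d ^+ 2)%:C%C <= sqnorm x -> sqnorm x <= ((2 * d) ^+ 2)%:C%C ->
     exists i, meval x (F i) != 0) ->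
  exists2 c : C, 0 < c & forall G : 'I_n -> mpoly.mpoly n C,
    (forall i x, sqnorm x <= ((2 * d) ^+ 2)%:C%C -> `|meval x (G i)| <= c) ->
    exists2 x, sqnorm x < (d ^+ 2)%:C%C &
      forall i, meval x (F i) + meval x (G i) = 0.
Proof.
move=> d0 F0 Fshell; have [c0 c00 Fc0] := exists_pos_lower_bound Fshell.
exists (c0 / 2%:R); first by rewrite divr_gt0 ?ltr0n.
have c20 : 0 < c0 / 2%:R by rewrite divr_gt0 ?ltr0n.
move=> G Gc; apply: contrapT => noz.
have /fin_all_exists [FG FGE] := fun i => meval_sum_exists (F i) (G i).
have [x _ x_le|c1 c10 Fc1] := @exists_pos_lower_bound R n 0 (d ^+ 2) n FG.
  apply: contrapT => Fx; have {}Fx i : meval x (F i) + meval x (G i) = 0.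
    by apply/eqP; apply: contrapT => /negP h; apply: Fx; exists i; rewrite FGE.
  have xr : sqnorm x \is Num.real by rewrite ger0_real // sqnorm_ge0.
  have dr : (d ^+ 2)%:C%C \is Num.real by rewrite ger0_real // lecR sqr_ge0.
  have [xd|dx] := real_ltP xr dr; first by apply: noz; exists x.
  have x2 : sqnorm x <= ((2 * d) ^+ 2)%:C%C.
    by apply: le_trans x_le _; rewrite lecR exprMn ler_peMl ?sqr_ge0 //; lra.
  have [i ci] := Fc0 x dx x2.
  have := Gc i x x2; have /eqP := Fx i.
  rewrite addr_eq0 => /eqP FxG; rewrite -normrN -FxG => le2.
  have := le_trans ci le2; rewrite ler_pdivlMr ?ltr0n // mulr_natr mulr2n.
  by rewrite gerDl => /(lt_le_trans c00); rewrite ltxx.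
have [e [e0 ec0 ec1]] := exists_smaller c20 c10.
have [N HN] := exists_homotopy_degree G complex_archi F0.
pose b : C := (1 + 2 * d)%:C%C.
have b0 : 0 < b by rewrite ltcR; lra.
pose s := e / b ^+ N.
have s0 : 0 < s by rewrite divr_gt0 ?exprn_gt0.
have sx (x : 'I_n -> C) i : sqnorm x <= ((2 * d) ^+ 2)%:C%C -> `|s * x i ^+ N| <= e.
  move=> xd; rewrite normrM (gtr0_norm s0) normrX /s -mulrA ler_piMr ?(ltW e0) //.
  rewrite mulrC ler_pdivrMr ?exprn_gt0 // mul1r lerXn2r ?nnegrE ?(ltW b0) //.
  apply: le_trans (_ : (2 * d)%:C%C <= _); last by rewrite lecR; lra.
  by apply: sqnorm_le_entry; rewrite -?rmorphXn ?lecR //; lra.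
have [|||x xd Hx] := HN s d%:C%C.
- by rewrite gt_eqF.
- by rewrite ltcR.
- move=> t x t1; have -> : 2%:R * d%:C%C = (2 * d)%:C%C by rewrite rmorphM rmorph_nat.
  rewrite -!rmorphXn => dx xd Hx; have [i ci] := Fc0 x dx xd.
  have Fi : `|meval x (F i)| = `|s * x i ^+ N + t * meval x (G i)|.
    have /eqP := Hx i; rewrite addrAC addr_eq0 => /eqP ->.
    by rewrite normrN.
  have : `|s * x i ^+ N + t * meval x (G i)| < c0.
    rewrite [ltRHS]splitr; apply: le_lt_trans (ler_normD _ _) _.
    apply: ltr_leD; first (apply: (@le_lt_trans _ _ e); [exact: sx|exact: ec0]).
    by rewrite normrM -[leRHS]mul1r ler_pM // Gc.
  by rewrite -Fi => /(le_lt_trans ci); rewrite ltxx.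
move: xd; rewrite -rmorphXn => xd; apply: noz.
have [||i ci] := Fc1 x; [exact: sqnorm_ge0 | exact: ltW |].
rewrite FGE in ci.
have x2 : sqnorm x <= ((2 * d) ^+ 2)%:C%C.
  by apply: le_trans (ltW xd) _; rewrite lecR exprMn ler_peMl ?sqr_ge0 //; lra.
have := Hx i; rewrite -addrA addrC => /eqP; rewrite addr_eq0 => /eqP h.
have := sx x i x2; rewrite -normrN -h => /(le_trans ci) /le_lt_trans /(_ ec1).
by rewrite ltxx.
Qed.

End Perturbation.

(** * The deformed system *)

Section Deformation.
Variables (R : realType) (r : nat) (a : 'M[int]_r) (Lambda : 'I_r -> {poly R[i]}).
Local Notation C := R[i].
Hypothesis Lambda_monic : forall i, Lambda i \is monic.
Variables qp qm : 'I_r -> {poly C}.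
Hypothesis q_solution : infinite_qq_solution a Lambda qp qm.

Definition monic_rhs (p : 'I_r -> {poly C}) i :=
  Lambda i * \prod_(j < r | j != i) p j ^+ `|a j i|%N.

Lemma qq_rhs_monic p i : (forall j, p j \is monic) ->
  qq_rhs a Lambda p i = monic_rhs p i.
Proof.
by move=> pm; congr (_ * _); apply: eq_bigr => j _; rewrite monic_exprz.
Qed.

Lemma same_monic_rhs p q i : (forall j, same_monic (p j) (q j)) ->
  same_monic (monic_rhs p i) (monic_rhs q i).
Proof.
move=> pq; apply: same_monicM; first by split.
elim/big_rec2: _ => [|j u v _ uv]; first by split; rewrite ?monic1.
by apply: same_monicM uv; apply: same_monicX.
Qed.

Let d i := (size (qp i)).-1.
Let e i := (size (qm i)).-1.

Lemma qp_monic i : qp i \is monic. Proof. by case: q_solution. Qed.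

Lemma qp_rhs i : qp i * qm i = monic_rhs qp i.
Proof. by case: q_solution => qpm ->; rewrite qq_rhs_monic. Qed.

Lemma qm_monic i : qm i \is monic.
Proof.
rewrite -(monicMl _ (qp_monic i)) qp_rhs.
by have [] : same_monic (monic_rhs qp i) (monic_rhs qp i);
  first by apply: same_monic_rhs => j; split=> //; apply: qp_monic.
Qed.

Lemma size_qp i : size (qp i) = (d i).+1.
Proof. by rewrite /d prednK // size_poly_gt0 monic_neq0 ?qp_monic. Qed.

Lemma size_qm i : size (qm i) = (e i).+1.
Proof. by rewrite /e prednK // size_poly_gt0 monic_neq0 ?qm_monic. Qed.

(** The coefficients of [q_+^i] and [q_-^i] below the leading one, which is [1]. *)
Definition unknown := {i : 'I_r & ('I_(d i) + 'I_(e i))%type}.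
Local Notation n := #|{: unknown}|.

Definition up i (k : 'I_(d i)) : 'I_n :=
  enum_rank (Tagged (fun i => ('I_(d i) + 'I_(e i))%type) (inl k)).
Definition um i (k : 'I_(e i)) : 'I_n :=
  enum_rank (Tagged (fun i => ('I_(d i) + 'I_(e i))%type) (inr k)).

(** The unknowns are measured from the coefficients of the given solution, which
    puts it at the origin. *)
Definition defp (x : 'I_n -> C) i := shift_coefs (qp i) (fun k => x (@up i k)).
Definition defm (x : 'I_n -> C) i := shift_coefs (qm i) (fun k => x (@um i k)).

Lemma same_monic_defp x i : same_monic (defp x i) (qp i).
Proof. by apply: same_monic_shift; rewrite ?size_qp ?qp_monic. Qed.

Lemma same_monic_defm x i : same_monic (defm x i) (qm i).
Proof. by apply: same_monic_shift; rewrite ?size_qm ?qm_monic. Qed.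

Lemma def_eq0 x : (forall i, defp x i = qp i) -> (forall i, defm x i = qm i) ->
  forall s, x s = 0.
Proof.
move=> xp xm s; rewrite -(enum_valK s); case: (enum_val s) => i [k|k].
  have /(congr1 (fun p : {poly C} => p`_k)) := xp i.
  by rewrite coef_shift_lt -[RHS]addr0 => /addrI.
have /(congr1 (fun p : {poly C} => p`_k)) := xm i.
by rewrite coef_shift_lt -[RHS]addr0 => /addrI.
Qed.

Lemma coef_defp_near x b i k : (forall s, `|x s| < b) -> 0 < b ->
  `|(qp i)`_k - (defp x i)`_k| < b.
Proof.
move=> xb b0; have [kd|dk] := ltnP k (d i); last first.
  by rewrite coef_shift_ge // subrr normr0.
rewrite (coef_shift_lt _ _ (Ordinal kd)) opprD addrA subrr sub0r normrN.
exact: xb.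
Qed.

Lemma coef_defm_near x b i k : (forall s, `|x s| < b) -> 0 < b ->
  `|(qm i)`_k - (defm x i)`_k| < b.
Proof.
move=> xb b0; have [ke|ek] := ltnP k (e i); last first.
  by rewrite coef_shift_ge // subrr normr0.
rewrite (coef_shift_lt _ _ (Ordinal ke)) opprD addrA subrr sub0r normrN.
exact: xb.
Qed.

Definition residual (x : 'I_n -> C) i := defp x i * defm x i - monic_rhs (defp x) i.

(** Both terms are monic of degree [d i + e i], so the leading terms cancel. *)
Lemma size_residual x i : (size (residual x i) <= d i + e i)%N.
Proof.
have [pm _ sp] := same_monic_defp x i; have [mm _ sm] := same_monic_defm x i.
have pms : size (defp x i * defm x i) = (d i + e i).+1.
  by rewrite size_monicM ?monic_neq0 // sp sm size_qp size_qm addnS addSn.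
have rs : same_monic (monic_rhs (defp x) i) (qp i * qm i).
  by rewrite qp_rhs; apply: same_monic_rhs => j; apply: same_monic_defp.
have [rm _ rsz] := rs.
have rsz' : size (monic_rhs (defp x) i) = (d i + e i).+1.
  by rewrite rsz size_monicM ?qp_monic ?monic_neq0 ?qm_monic // size_qp size_qm addnS addSn.
apply/leq_sizeP => j; rewrite leq_eqVlt => /predU1P[<-|jlt].
  have h1 : (defp x i * defm x i)`_(d i + e i) = 1.
    have /monicP : defp x i * defm x i \is monic by rewrite monicMl.
    by rewrite lead_coefE pms.
  have h2 : (monic_rhs (defp x) i)`_(d i + e i) = 1.
    by have /monicP := rm; rewrite lead_coefE rsz'.
  by rewrite coefB h1 h2 subrr.
by rewrite coefB !nth_default ?subrr ?pms ?rsz'.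
Qed.

Lemma size_def_Wronskian x i :
  (size (Wronskian (defp x i) (defm x i)) <= d i + e i)%N.
Proof.
have [pm _ sp] := same_monic_defp x i; have [mm _ sm] := same_monic_defm x i.
have := size_Wronskian (monic_neq0 pm) (monic_neq0 mm).
by rewrite sp sm size_qp size_qm addnS addSn.
Qed.

(** This numbering makes the system square: below the leading term, the two sides
    of the [i]-th equation have [d i + e i] coefficients, which is the number of
    unknowns in [q_+^i] and [q_-^i]. *)
Definition eq_index (s : 'I_n) : 'I_r := tag (enum_val s).
Definition coef_index (s : 'I_n) : nat :=
  match tagged (enum_val s) with inl k => k | inr k => d (tag (enum_val s)) + k end.

Lemma coefs_eq0 (g : 'I_r -> {poly C}) :
  (forall i, (size (g i) <= d i + e i)%N) ->
  (forall s, (g (eq_index s))`_(coef_index s) = 0) -> forall i, g i = 0.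
Proof.
move=> gs g0 i; apply/polyP => k; rewrite coef0.
have [kd|dk] := ltnP k (d i).
  have := g0 (@up i (Ordinal kd)).
  by rewrite /eq_index /coef_index /up enum_rankK.
have [ke|ek] := ltnP (k - d i) (e i).
  have := g0 (@um i (Ordinal ke)).
  by rewrite /eq_index /coef_index /um enum_rankK /= subnKC.
rewrite nth_default // (leq_trans (gs i)) //; lia.
Qed.

Lemma poly_family_defp i : poly_family (fun x => defp x i).
Proof.
apply: poly_familyD (poly_family_const _ _) _; apply: poly_family_sum => k.
exact: poly_familyM (poly_family_var _ _) (poly_family_const _ _).
Qed.

Lemma poly_family_defm i : poly_family (fun x => defm x i).
Proof.
apply: poly_familyD (poly_family_const _ _) _; apply: poly_family_sum => k.
exact: poly_familyM (poly_family_var _ _) (poly_family_const _ _).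
Qed.

Lemma poly_family_residual i : poly_family (fun x => residual x i).
Proof.
apply: poly_familyB.
  exact: poly_familyM (poly_family_defp i) (poly_family_defm i).
apply: poly_familyM (poly_family_const _ _) _; apply: poly_family_prod => j.
exact/poly_familyX/poly_family_defp.
Qed.

Lemma poly_family_Wronskian i :
  poly_family (fun x => Wronskian (defp x i) (defm x i)).
Proof.
have pP := poly_family_defp i; have mP := poly_family_defm i.
by apply: poly_familyB; apply: poly_familyM => //; apply: poly_family_deriv.
Qed.

Definition solves (t : 'I_r -> C) x := forall s,
  (residual x (eq_index s))`_(coef_index s) +
  t (eq_index s) *
    (Wronskian (defp x (eq_index s)) (defm x (eq_index s)))`_(coef_index s) = 0.

Lemma solvesP t x : solves t x -> forall i,
  defp x i * defm x i + t i *: Wronskian (defp x i) (defm x i) =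
  qq_rhs a Lambda (defp x) i.
Proof.
move=> tx i; rewrite qq_rhs_monic => [|j]; last by case: (same_monic_defp x j).
apply/eqP; rewrite -subr_eq0 addrAC; apply/eqP; move: i.
apply: (coefs_eq0 (g := fun i => residual x i + t i *: Wronskian (defp x i) (defm x i))).
  move=> i; apply: leq_trans (size_polyD _ _) _.
  rewrite geq_max size_residual (leq_trans (size_scale_leq _ _)) //.
  exact: size_def_Wronskian.
by move=> s; rewrite coefD coefZ.
Qed.

Lemma solves0_solution x : solves (fun=> 0) x ->
  infinite_qq_solution a Lambda (defp x) (defm x).
Proof.
move=> x0; split=> [i|i]; first by case: (same_monic_defp x i).
by rewrite -(solvesP x0) scale0r addr0.
Qed.

Lemma same_degrees_def x : same_degrees qp qm (defp x) (defm x).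
Proof.
move=> i; have [_ _ sp] := same_monic_defp x i.
by have [_ _ sm] := same_monic_defm x i.
Qed.

Lemma sqnorm_lt_entry m (x : 'I_m -> C) (b : R) s :
  0 < b -> sqnorm x < (b ^+ 2)%:C%C -> `|x s| < b%:C%C.
Proof.
move=> b0 xb; have bC : 0 <= b%:C%C by rewrite lecR ltW.
rewrite -(@ltr_pXn2r _ 2) ?nnegrE // -[ltRHS]rmorphXn.
exact: le_lt_trans (sqnorm_ge x s) xb.
Qed.

(** A small [x] gives polynomials of the same degrees as [q], with coefficients in
    the isolating neighbourhood. *)
Lemma isolated_zero : isolated_solution a Lambda qp qm ->
  exists2 b : R, 0 < b & forall x, sqnorm x < (b ^+ 2)%:C%C ->
    solves (fun=> 0) x -> forall s, x s = 0.
Proof.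
move=> [_ [_ [V nV VA]]]; set N := max_size qp qm in nV VA.
have /nbhs_ballP [c /= c0 cV] := nV.
have cE : c = (complex.Re c)%:C%C by rewrite RRe_real // gtr0_real.
have b0 : 0 < complex.Re c by rewrite -ltcR -cE.
exists (complex.Re c) => // x xb x0.
have xs s : `|x s| < c by rewrite cE; apply: sqnorm_lt_entry.
have Vx : V (coef_tuple N (defp x) (defm x)).
  apply: cV; split; split=> // i k; rewrite /= !mxE.
    exact: coef_defp_near.
  exact: coef_defm_near.
have : (V `&` [set coef_tuple N s.1 s.2 | s in
      [set s | infinite_qq_solution a Lambda s.1 s.2 /\
               same_degrees qp qm s.1 s.2]])%classic (coef_tuple N (defp x) (defm x)).
  split=> //; exists (defp x, defm x) => //; split=> /=.
    exact: solves0_solution.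
  exact: same_degrees_def.
rewrite VA /= => -[/matrixP xp /matrixP xm].
have Nle i : (size (qp i) <= N)%N /\ (size (qm i) <= N)%N.
  apply/andP; rewrite -geq_max.
  exact: (leq_bigmax (F := fun i => maxn (size (qp i)) (size (qm i)))).
apply: def_eq0 => i; apply/polyP => k.
  have [kN|Nk] := ltnP k N.
    by have := xp i (Ordinal kN); rewrite !mxE.
  have [_ _ sp] := same_monic_defp x i.
  by rewrite !nth_default // ?sp (leq_trans _ Nk) // (Nle i).1.
have [kN|Nk] := ltnP k N.
  by have := xm i (Ordinal kN); rewrite !mxE.
have [_ _ sm] := same_monic_defm x i.
by rewrite !nth_default // ?sm (leq_trans _ Nk) // (Nle i).2.
Qed.

(** The Wronskian terms are bounded on the ball, so a small [t] makes them a small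
    perturbation. *)
Lemma exists_nearby_solution (b : R) : 0 < b ->
  (forall x, sqnorm x <= ((2 * b) ^+ 2)%:C%C -> solves (fun=> 0) x ->
     forall s, x s = 0) ->
  exists2 eta : R, 0 < eta & forall t, (forall i, `|t i| < eta%:C%C) ->
    exists2 x, sqnorm x < (b ^+ 2)%:C%C & solves t x.
Proof.
move=> b0 iso.
have /fin_all_exists [F FE] : forall s, exists p : mpoly.mpoly n C, forall x,
    meval x p = (residual x (eq_index s))`_(coef_index s).
  by move=> s; apply/poly_family_coef/poly_family_residual.
have /fin_all_exists [W WE] : forall s, exists p : mpoly.mpoly n C, forall x,
    meval x p = (Wronskian (defp x (eq_index s)) (defm x (eq_index s)))`_(coef_index s).
  by move=> s; apply/poly_family_coef/poly_family_Wronskian.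
have solvesE t x : solves t x <->
    forall s, meval x (F s) + t (eq_index s) * meval x (W s) = 0.
  by split=> h s; have := h s; rewrite FE WE.
have def0 i : defp (fun=> 0) i = qp i /\ defm (fun=> 0) i = qm i.
  by rewrite /defp /defm /shift_coefs !big1 ?addr0 // => k _; rewrite mul0r.
have F0 s : meval (fun=> 0) (F s) = 0.
  rewrite FE /residual !(def0 _).1 (def0 _).2 qp_rhs.
  rewrite (_ : monic_rhs (defp _) _ = monic_rhs qp (eq_index s)) ?subrr ?coef0 //.
  by congr (_ * _); apply: eq_bigr => j _; rewrite (def0 j).1.
have [x bx xb|c c0 Hc] := perturbed_zero b0 F0.
  apply: contrapT => Fx; have x0 : forall s, x s = 0.
    apply: iso xb _; apply/solvesE => s; rewrite mul0r addr0.
    by apply/eqP; apply: contrapT => /negP h; apply: Fx; exists s.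
  move: bx; rewrite /sqnorm big1 => [|s _]; last by rewrite x0 normr0 expr0n.
  by rewrite lecR leNgt exprn_gt0.
have b20 : 0 <= (2 * b)%:C%C :> C by rewrite lecR mulr_ge0 ?ltW.
have [K K0 WK] : exists2 K : C, 0 <= K & forall s x,
    (forall s, `|x s| <= (2 * b)%:C%C) -> `|meval x (W s)| <= K.
  apply: uniform_bound => [s K K' KK' + x xb|s].
    by move=> /(_ x xb) /le_trans; apply.
  exact: meval_bounded.
have K1 : 0 < K + 1 by rewrite ltr_wpDl.
have cE : c / (K + 1) = (complex.Re (c / (K + 1)))%:C%C.
  by rewrite RRe_real // gtr0_real // divr_gt0.
exists (complex.Re (c / (K + 1))); first by rewrite -ltcR -cE divr_gt0.
rewrite -cE => t tc.
have /fin_all_exists [G GE] := fun s => meval_scale_exists (t (eq_index s)) (W s).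
have [s x xb|x xb Hx] := Hc G.
  rewrite GE normrM; have xs s' : `|x s'| <= (2 * b)%:C%C.
    by apply: sqnorm_le_entry; rewrite -?rmorphXn.
  apply: le_trans (_ : c / (K + 1) * K <= _).
    by rewrite ler_pM // ?WK // ltW.
  by rewrite mulrAC ler_pdivrMr // ler_pM2l // lerDl ler01.
by exists x => //; apply/solvesE => s; have := Hx s; rewrite GE.
Qed.

(** Choosing the closest solution at each [t] makes the choice converge: it is at
    least as close as any solution known to exist nearby. *)
Lemma exists_closest_solution (b : R) t :
  (exists2 x, sqnorm x <= b%:C%C & solves t x) ->
  exists2 x, solves t x & forall y, solves t y -> sqnorm x <= sqnorm y.
Proof.
move=> [x0 x0b x0t].
have /fin_all_exists [F FE] : forall s, exists p : mpoly.mpoly n C, forall x,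
    meval x p = (residual x (eq_index s) + (t (eq_index s))%:P *
      Wronskian (defp x (eq_index s)) (defm x (eq_index s)))`_(coef_index s).
  move=> s; apply/poly_family_coef/poly_familyD; first exact: poly_family_residual.
  exact: poly_familyM (poly_family_const _ _) (poly_family_Wronskian _).
have solvesE x : solves t x <-> forall s, meval x (F s) = 0.
  have FE' s : meval x (F s) = (residual x (eq_index s))`_(coef_index s) +
      t (eq_index s) *
      (Wronskian (defp x (eq_index s)) (defm x (eq_index s)))`_(coef_index s).
    by rewrite FE -coefCM -coefD.
  by split=> h s; have := h s; rewrite FE'.
have [|x [xb Fx xmin]] := @exists_min_norm_zero R _ b _ F.
  by exists x0 => //; apply/solvesE.
by exists x => [|y /solvesE]; [apply/solvesE|apply: xmin].
Qed.

End Deformation.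

(** * Lifting an isolated solution *)

Theorem theorem4p1 (R : realType) (g : lieAlgType R[i])
    (g_simple : simple_lie g)
    (h : {vspace g}) (h_cartan : cartan_subalgebra h)
    (r : nat) (alpha : 'I_r -> 'Hom(subvs_of h, R[i]^o))
    (alpha_simple : simple_roots alpha)
    (alphav : 'I_r -> subvs_of h)
    (alphav_coroot : forall i, is_coroot (alpha i) (alphav i))
    (a : 'M[int]_r) (a_cartan : is_cartan_matrix alpha alphav a)
    (Lambda : 'I_r -> {poly R[i]})
    (Lambda_monic : forall i, Lambda i \is monic)
    (qp qm : 'I_r -> {poly R[i]})
    (q_isolated : isolated_solution a Lambda qp qm) :
  exists (eps : R) (Qp Qm : subvs_of h -> 'I_r -> {poly R[i]}),
    [/\ 0 < eps,
        lifts alpha eps qp qm Qp Qm &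
        forall Z : subvs_of h, t_ball alpha eps Z ->
          qq_system a Lambda (fun i => alpha i Z) (Qp Z) (Qm Z)].
Proof.
have q_sol := q_isolated.1.
have [b b0 iso] := isolated_zero Lambda_monic q_sol q_isolated.
pose n := #|{: unknown qp qm}|.
have nearby (d : R) : 0 < d -> d <= b / 3 ->
    exists2 eta : R, 0 < eta & forall t, (forall i, `|t i| < eta%:C%C) ->
      exists2 x : 'I_n -> R[i], sqnorm x < (d ^+ 2)%:C%C & solves a Lambda t x.
  move=> d0 db; apply: (exists_nearby_solution q_sol d0) => x xd.
  apply: iso; apply: le_lt_trans xd _.
  by rewrite ltcR ltrXn2r // ?nnegrE; lra.
have b30 : 0 < b / 3 by rewrite divr_gt0.
have [eps eps0 nearby0] := nearby _ b30 (lexx _).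
pose t (Z : subvs_of h) (i : 'I_r) : R[i] := (alpha i Z)^-1.
have /choice [x xP] : forall Z, exists x : 'I_n -> R[i], t_ball alpha eps Z ->
    solves a Lambda (t Z) x /\
    forall y : 'I_n -> R[i], solves a Lambda (t Z) y -> sqnorm x <= sqnorm y.
  move=> Z; have [Zeps|] := pselect (t_ball alpha eps Z); last by exists (fun=> 0).
  have [y yb yt] := nearby0 (t Z) (fun i => (Zeps i).2).
  have [|x xt xmin] := @exists_closest_solution _ _ a Lambda qp qm ((b / 3) ^+ 2) (t Z).
    by exists y => //; apply: ltW.
  by exists x.
have x_small (c : R[i]) : 0 < c -> exists2 eta : R, 0 < eta &
    forall Z, t_ball alpha eta Z -> t_ball alpha eps Z /\ forall s, `|x Z s| < c.
  move=> c0; have cE : c = (complex.Re c)%:C%C by rewrite RRe_real // gtr0_real.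
  pose d := Num.min (b / 3) (complex.Re c).
  have d0 : 0 < d by rewrite lt_min b30 -ltcR -cE.
  have [|eta eta0 near_d] := nearby d d0; first by rewrite ge_min lexx.
  exists (Num.min eps eta) => [|Z Zeta]; first by rewrite lt_min eps0.
  have Zeps : t_ball alpha eps Z.
    move=> i; split; first exact: (Zeta i).1.
    by apply: lt_le_trans (Zeta i).2 _; rewrite lecR ge_min lexx.
  split=> // s; have [_ xmin] := xP Z Zeps.
  have [|y yd yt] := near_d (t Z).
    move=> i; apply: lt_le_trans (Zeta i).2 _.
    by rewrite lecR ge_min lexx orbT.
  apply: lt_le_trans (_ : d%:C%C <= c).
    exact: sqnorm_lt_entry d0 (le_lt_trans (xmin y yt) yd).
  by rewrite cE lecR ge_min lexx orbT.
have tV Z i : t_ball alpha eps Z -> alpha i Z * t Z i = 1.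
  by move=> Zeps; rewrite mulfV // (Zeps i).1.
exists eps, (fun Z => defp (x Z)), (fun Z i => t Z i *: defm (x Z) i).
split=> // [|Z Zeps i]; last first.
  rewrite -(solvesP Lambda_monic q_sol (xP Z Zeps).1) addrC.
  rewrite -scalerAr scalerA tV // scale1r; congr (_ + _).
  by rewrite /Wronskian derivZ -scalerAr -scalerAl -scalerBr.
split.
- by move=> Z _ i; case: (same_monic_defp q_sol (x Z) i).
- move=> Z Zeps i; have [-> sm] := same_degrees_def Lambda_monic q_sol (x Z) i.
  by rewrite size_scale ?invr_eq0 ?(Zeps i).1.
- move=> i k A /nbhs_ballP [c /= c0 cA]; have [eta eta0 small] := x_small c c0.
  exists eta => // Z /small [_ xc]; apply: cA.
  exact: coef_defp_near.
move=> i k A /nbhs_ballP [c /= c0 cA]; have [eta eta0 small] := x_small c c0.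
exists eta => // Z /small [Zeps xc]; apply: cA.
rewrite /= scalerA tV // scale1r.
exact: coef_defm_near.
Qed.
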